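(* For every fixed positive integer $k$, the following problem can be solved in polynomial time: given a list $Q=(q_1,\ldots,q_k)$ of $k$ sequences of bins with pallet symbols and a positive integer $p$, decide whether there is a processing of $Q$ with at most $p$ stack-up places.
   Context: A bin $b$ carries a pallet symbol $\mathit{plt}(b)$ (a positive integer). In an instance, all bins are pairwise distinct, and for every pallet symbol occurring, the sequences together contain at least two bins destined for it. A subsequence of $q=(b_1,\ldots,b_n)$ is a suffix $q'=(b_j,\ldots,b_n)$ (possibly empty), and $q-q'=(b_1,\ldots,b_{j-1})$. A configuration is $(Q,Q')$ with $Q'=(q'_1,\ldots,q'_k)$, each $q'_j$ a subsequence of $q_j$. A pallet $t$ is open in $(Q,Q')$ if some bin for $t$ lies in some $q'_i$ and some bin for $t$ lies in some $q_j-q'_j$. A transformation step removes the first bin of one nonempty $q'_i$. A processing of $Q$ is a sequence of transformation steps transforming $(Q,Q)$ into the configuration with all sequences empty; it uses at most $p$ stack-up places if every configuration along it has at most $p$ open pallets. *)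

(* Defs.v *)
From mathcomp Require Import all_boot.
Set Implicit Arguments.
Unset Strict Implicit.
Unset Printing Implicit Defensive.

(* A bin is a pair (identifier, pallet symbol); plt b = b.2.
   Distinctness of bins is distinctness of these pairs. *)
Definition bin := (nat * nat)%type.
Definition plt (b : bin) : nat := b.2.

Definition valid_instance (k : nat) (Q : seq (seq bin)) : bool :=
  [&& size Q == k,
      uniq (flatten Q),
      all (fun b => 0 < plt b) (flatten Q) &
      all (fun b => 1 < count (fun b' => plt b' == plt b) (flatten Q))
          (flatten Q)].

(* A configuration (Q, Q') is represented by the list Q' of remaining
   suffixes; q_j - q'_j is the corresponding prefix of q_j. *)
Definition removed (Q Q' : seq (seq bin)) : seq (seq bin) :=
  map (fun qq : seq bin * seq bin => take (size qq.1 - size qq.2) qq.1)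
      (zip Q Q').

Definition is_open (Q Q' : seq (seq bin)) (t : nat) : bool :=
  (t \in map plt (flatten Q')) && (t \in map plt (flatten (removed Q Q'))).

Definition num_open (Q Q' : seq (seq bin)) : nat :=
  size (filter (is_open Q Q') (undup (map plt (flatten Q)))).

Definition trans_step (Q' Q'' : seq (seq bin)) : Prop :=
  exists2 i, i < size Q' &
    nth [::] Q' i != [::] /\ Q'' = set_nth [::] Q' i (behead (nth [::] Q' i)).

Definition all_empty (Q' : seq (seq bin)) : bool := all (fun q => q == [::]) Q'.

(* A processing of Q: a sequence of configurations Q = C_0, C_1, ..., C_m
   with consecutive ones related by a transformation step and C_m having
   all sequences empty.  It is given by the list [C_1; ...; C_m]. *)
Definition processing (Q : seq (seq bin)) (cs : seq (seq (seq bin))) : Prop :=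
  (forall j, j < size cs ->
     trans_step (nth Q (Q :: cs) j) (nth Q cs j)) /\
  all_empty (last Q cs).

Definition uses_at_most (Q : seq (seq bin)) (cs : seq (seq (seq bin))) (p : nat)
  : Prop := forall C, C \in Q :: cs -> num_open Q C <= p.

Definition solvable (Q : seq (seq bin)) (p : nat) : Prop :=
  exists cs, processing Q cs /\ uses_at_most Q cs p.

Inductive tk := T0 | T1 | TNum | TSeq.

Fixpoint bits_aux (fuel n : nat) : seq tk :=
  match fuel with
  | 0 => [::]
  | fuel'.+1 =>
      if n == 0 then [::] else (if odd n then T1 else T0) :: bits_aux fuel' n./2
  end.
Definition bits (n : nat) : seq tk := bits_aux n n.

Definition enc_num (n : nat) : seq tk := bits n ++ [:: TNum].
Definition enc_bin (b : bin) : seq tk := enc_num b.1 ++ enc_num b.2.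
Definition enc_seq (q : seq bin) : seq tk := flatten (map enc_bin q) ++ [:: TSeq].
Definition enc_input (Q : seq (seq bin)) (p : nat) : seq tk :=
  flatten (map enc_seq Q) ++ enc_num p.

Inductive dir := DL | DR | DS.

(* tape symbols: Some t, or None for the blank; finitely many states *)
Record TM := {
  tm_n : nat;
  tm_start : 'I_tm_n;
  tm_delta : 'I_tm_n -> option tk -> option ('I_tm_n * option tk * dir);
  tm_acc : 'I_tm_n -> bool
}.

Record tconf (M : TM) := TConf {
  tc_st : 'I_(tm_n M);
  tc_left : seq (option tk);   (* cells left of the head, nearest first *)
  tc_cur : option tk;
  tc_right : seq (option tk)   (* cells right of the head, nearest first *)
}.

Definition tm_init (M : TM) (w : seq tk) : tconf M :=
  TConf (tm_start M) [::] (head None (map Some w)) (behead (map Some w)).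

Definition tm_halted (M : TM) (c : tconf M) : bool :=
  if tm_delta (tc_st c) (tc_cur c) is Some _ then false else true.

Definition tm_step (M : TM) (c : tconf M) : tconf M :=
  match tm_delta (tc_st c) (tc_cur c) with
  | None => c
  | Some (q, s, d) =>
      match d with
      | DS => TConf q (tc_left c) s (tc_right c)
      | DL => TConf q (behead (tc_left c)) (head None (tc_left c))
                    (s :: tc_right c)
      | DR => TConf q (s :: tc_left c) (head None (tc_right c))
                    (behead (tc_right c))
      end
  end.

Definition tm_run (M : TM) (n : nat) (c : tconf M) : tconf M := iter n (@tm_step M) c.

Definition tm_answers_within (M : TM) (w : seq tk) (n : nat) (b : bool) : bool :=
  let c := tm_run n (tm_init M w) in tm_halted c && (tm_acc (tc_st c) == b).

Definition poly_time_solvable (k : nat) : Prop :=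
  exists (M : TM) (c d : nat),
    forall (Q : seq (seq bin)) (p : nat),
      valid_instance k Q -> 0 < p ->
      exists b : bool,
        tm_answers_within M (enc_input Q p) (c * (size (enc_input Q p)).+1 ^ d) b
        /\ (b = true <-> solvable Q p).

(* Main.v *)
(* A configuration is a k-tuple of positions in the input, so for an input of length N
   there are at most (N+1)^k of them.  Number them in base N+1: advancing pointer j adds
   (N+1)^j, so a single pass over the numbers in increasing order, which marks the
   successors of each marked tuple with few enough open pallets, decides reachability.
   Pointers advance token by token, and a bin counts as removed once its first [TNum] has
   been passed; advances inside a bin do not change the configuration.

   The pass is written in a language of nested loops over the input positions, acting on
   heads and bit tracks.  A one-tape machine keeps in each block of cells one bit per head
   and per track and executes an instruction by sweeping over the blocks; as all loops
   range over the input, the number of instructions is polynomial by induction on the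
   program. *)
Require Import Defs.
From mathcomp Require Import all_boot.
From HB Require Import structures.
From mathcomp Require Import zify.
Set Implicit Arguments.
Unset Strict Implicit.
Unset Printing Implicit Defensive.

(** * Two-exit Turing machines *)

(** The program computes only by moving heads, so every number it handles is a head position. Two
    constructions come from this. The bound [p] is written in binary and may be exponential in the
    input length, hence it is decoded only up to a cap. The address of a table entry cannot be
    computed from a tuple, hence for each pointer a further head is kept at the address of the tuple
    in which that pointer is advanced, and these heads all move on by one block per tuple. Pallet
    symbols may be exponential as well and are never decoded: two bins are compared token by token
    in place, and an open pallet is counted through one representative bin. The machine starts on
    the first token with nothing but blanks to its left, so the blocks are laid out leftwards while
    the input is consumed to the right. A blank reads as bit 0, which lets the table extend far
    beyond the blocks of the input without any initialisation. *)

Definition sym := option tk.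

Definition tk_code (a : tk) : nat :=
  match a with T0 => 0 | T1 => 1 | TNum => 2 | TSeq => 3 end.
Definition tk_decode (n : nat) : tk :=
  match n with 0 => T0 | 1 => T1 | 2 => TNum | _ => TSeq end.
Lemma tk_codeK : cancel tk_code tk_decode. Proof. by case. Qed.
HB.instance Definition _ := Equality.copy tk (can_type tk_codeK).

Record tape := Tape { tl : seq sym; tc : sym; tr : seq sym }.

Definition mv (d : dir) (s : sym) (t : tape) : tape :=
  match d with
  | DS => Tape (tl t) s (tr t)
  | DL => Tape (behead (tl t)) (head None (tl t)) (s :: tr t)
  | DR => Tape (s :: tl t) (head None (tr t)) (behead (tr t))
  end.

(** The Boolean carried by an exit selects the continuation, so tests, sequences and loops are built
    without naming states. The transition function is total: a machine stops only through an
    exit. *)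
Record mach := Mach {
  mst : finType;
  mstart : mst;
  mdelta : mst -> sym -> (mst + bool) * sym * dir }.

(** The step count is exact here and relaxed to a bound in [runs]; exactness locates the exiting
    step when the machine is turned into a [TM]. *)
Fixpoint reach (M : mach) n (x : mst M) t r t' : Prop :=
  if n is n'.+1 then
    let: (y, s, d) := mdelta x (tc t) in
    match y with
    | inl x' => reach n' x' (mv d s t) r t'
    | inr r' => [/\ n' = 0, r' = r & mv d s t = t']
    end
  else False.

Definition runs M t r t' n :=
  exists2 m, m <= n & reach m (mstart M) t r t'.

Lemma runs_le M t r t' n n' : n <= n' -> runs M t r t' n -> runs M t r t' n'.
Proof. by move=> le_n [m le_m h]; exists m => //; apply: leq_trans le_n. Qed.

Definition act (f : sym -> sym * dir * bool) : mach :=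
  @Mach unit tt (fun _ x => let: (s, d, r) := f x in (inr r, s, d)).

(** The exiting step of [C] already enters [A] or [B], so composition costs no extra step and time
    bounds simply add up. *)
Definition ite (C A B : mach) : mach :=
  @Mach (mst C + (mst A + mst B))%type (inl (mstart C)) (fun x s =>
    match x with
    | inl x => let: (y, s', d) := mdelta x s in
        (match y with
         | inl y => inl (inl y)
         | inr true => inl (inr (inl (mstart A)))
         | inr false => inl (inr (inr (mstart B)))
         end, s', d)
    | inr (inl x) => let: (y, s', d) := mdelta x s in
        (match y with inl y => inl (inr (inl y)) | inr r => inr r end, s', d)
    | inr (inr x) => let: (y, s', d) := mdelta x s in
        (match y with inl y => inl (inr (inr y)) | inr r => inr r end, s', d)
    end).

Definition loop (A : mach) : mach :=
  @Mach (mst A) (mstart A) (fun x s =>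
    let: (y, s', d) := mdelta x s in
    (match y with
     | inl y => inl y
     | inr true => inl (mstart A)
     | inr false => inr false
     end, s', d)).

Definition seqm A B := ite A B B.

Lemma runs_act f t s d r : f (tc t) = (s, d, r) -> runs (act f) t r (mv d s t) 1.
Proof. by move=> e; exists 1 => //=; rewrite e. Qed.

Lemma runs_ite (C A B : mach) t r t' r' t'' n m :
  runs C t r t' n -> runs (if r then A else B) t' r' t'' m ->
  runs (ite C A B) t r' t'' (n + m).
Proof.
move=> [n' le_n hC] [m' le_m hA]; exists (n' + m'); first exact: leq_add.
rewrite [mstart _]/=; elim: n' {n le_n} (mstart C) t hC => [//|n IHn] x t /=.
case: (mdelta x (tc t)) => [[[y|r1] s] d]; first exact: IHn.
move=> [-> -> ->] {IHn}; rewrite add0n; case: r hA => /=; [move: (mstart A)|move: (mstart B)];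
  elim: m' {m le_m} t' => [//|m IHm] t' z /=; case: mdelta => [[[y'|r2] s'] d']; exact: IHm || exact.
Qed.

Lemma runs_seq A B t r t' r' t'' n m :
  runs A t r t' n -> runs B t' r' t'' m -> runs (seqm A B) t r' t'' (n + m).
Proof. by move=> hA hB; apply: runs_ite hA _; case: r. Qed.

Lemma runs_loop_stop A t t' n : runs A t false t' n -> runs (loop A) t false t' n.
Proof.
case=> m le_m h; exists m => //; rewrite [mstart _]/=.
elim: m {le_m} (mstart A) t h => [//|m IHm] x t /=.
by case: mdelta => [[[y|r1] s] d]; [exact: IHm | case=> -> -> ->].
Qed.

Lemma runs_loop_next A t t' t'' n m :
  runs A t true t' n -> runs (loop A) t' false t'' m ->
  runs (loop A) t false t'' (n + m).
Proof.
move=> [n' le_n hA] [m' le_m hL]; exists (n' + m'); first exact: leq_add.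
rewrite [mstart _]/=; elim: n' {n le_n} (mstart A) t hA => [//|n IHn] x t /=.
by case: mdelta => [[[y|r1] s] d]; [exact: IHn | case=> -> -> ->].
Qed.

(* The simulated one-way tape runs to the left: cell [0] is the first one, [J] is
   the part of the real tape to its right, and the head scans cell [h]. *)
Definition at_ (J : seq sym) (T : nat -> sym) (h : nat) (t : tape) : Prop :=
  [/\ tr t = rev (mkseq T h) ++ J, tc t = T h &
      forall i, nth None (tl t) i = T (h.+1 + i)].

(** Quantifying over [J] is a frame condition: the effect does not depend on what lies to the right
    of cell [0], and that part is restored at the end. *)
Definition runsA (M : mach) T h r T' h' n : Prop :=
  forall J t, at_ J T h t -> exists2 t', at_ J T' h' t' & runs M t r t' n.

Definition upd {A : Type} (f : nat -> A) i v : nat -> A :=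
  fun j => if j == i then v else f j.

Lemma mkseq_rev (T : nat -> sym) h : rev (mkseq T h.+1) = T h :: rev (mkseq T h).
Proof. by rewrite /mkseq -addn1 iotaD map_cat rev_cat. Qed.

Lemma at_fwd J T h t : at_ J T h t -> at_ J T h.+1 (mv DL (tc t) t).
Proof.
case=> e1 e2 e3; split=> /=; first by rewrite mkseq_rev e1 e2.
  by have := e3 0; rewrite addn0 nth0.
by move=> i; rewrite nth_behead e3 addnS.
Qed.

Lemma at_bwd J T h t : at_ J T h.+1 t -> at_ J T h (mv DR (tc t) t).
Proof.
case=> e1 e2 e3; split=> /=; rewrite ?e1 ?mkseq_rev //.
by case=> [|i] /=; rewrite ?addn0 // e3 addnS.
Qed.

Lemma at_write J T h t s : at_ J T h t -> at_ J (upd T h s) h (mv DS s t).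
Proof.
case=> e1 e2 e3; split=> /=; rewrite ?/upd ?eqxx //.
  rewrite e1; congr (rev _ ++ _); apply/eq_in_map => i; rewrite mem_iota => hi.
  by case: eqP => //; lia.
by move=> i; rewrite e3; case: eqP => //; lia.
Qed.

Lemma runsA_le M T h r T' h' n n' :
  n <= n' -> runsA M T h r T' h' n -> runsA M T h r T' h' n'.
Proof.
move=> le_n hM J t /hM [t' at' ht]; exists t' => //; exact: runs_le ht.
Qed.

Lemma runsA_ite (C A B : mach) T h r T' h' r' T'' h'' n m :
  runsA C T h r T' h' n -> runsA (if r then A else B) T' h' r' T'' h'' m ->
  runsA (ite C A B) T h r' T'' h'' (n + m).
Proof.
move=> hC hA J t /hC [t' /hA [t'' at'' ht'] ht]; exists t'' => //.
exact: runs_ite ht ht'.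
Qed.

Lemma runsA_seq A B T h r T' h' r' T'' h'' n m :
  runsA A T h r T' h' n -> runsA B T' h' r' T'' h'' m ->
  runsA (seqm A B) T h r' T'' h'' (n + m).
Proof. by move=> hA hB; apply: runsA_ite hA _; case: r. Qed.

Lemma runsA_loop_stop A T h T' h' n :
  runsA A T h false T' h' n -> runsA (loop A) T h false T' h' n.
Proof.
by move=> hA J t /hA [t' at' ht]; exists t' => //; apply: runs_loop_stop.
Qed.

Lemma runsA_loop_next A T h T' h' T'' h'' n m :
  runsA A T h true T' h' n -> runsA (loop A) T' h' false T'' h'' m ->
  runsA (loop A) T h false T'' h'' (n + m).
Proof.
move=> hA hL J t /hA [t' /hL [t'' at'' ht'] ht]; exists t'' => //.
exact: runs_loop_next ht ht'.
Qed.

Definition ret b := act (fun x => (x, DS, b)).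
Definition go d := act (fun x => (x, d, true)).
Definition wr s := act (fun _ => (s, DS, true)).
Definition read1 := act (fun x => (x, DS, x == Some T1)).
Fixpoint goN d n := if n is n'.+1 then seqm (go d) (goN d n') else ret true.

Lemma tape_stay t : mv DS (tc t) t = t. Proof. by case: t. Qed.

Lemma runs_ret b t : runs (ret b) t b t 1.
Proof. by rewrite -{2}(tape_stay t); apply: runs_act. Qed.

Lemma runsA_ret b T h : runsA (ret b) T h b T h 1.
Proof. by move=> J t ht; exists t => //; apply: runs_ret. Qed.

Lemma runsA_read1 T h : runsA read1 T h (T h == Some T1) T h 1.
Proof.
move=> J t ht; exists t => //; case: (ht) => _ <- _.
by rewrite -{3}(tape_stay t); apply: runs_act.
Qed.

Lemma runsA_wr s T h : runsA (wr s) T h true (upd T h s) h 1.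
Proof. by move=> J t ht; exists (mv DS s t); [apply: at_write | apply: runs_act]. Qed.

Lemma runsA_goL n T h : runsA (goN DL n) T h true T (h + n) n.+1.
Proof.
elim: n h => [|n IHn] h; first by rewrite addn0; apply: runsA_ret.
apply: (@runsA_seq _ _ _ _ true T h.+1 _ _ _ 1); last by rewrite addnS -addSn; apply: IHn.
by move=> J t ht; exists (mv DL (tc t) t); [apply: at_fwd | apply: runs_act].
Qed.

Lemma runsA_goR n T h : runsA (goN DR n) T (h + n) true T h n.+1.
Proof.
elim: n => [|n IHn]; first by rewrite addn0; apply: runsA_ret.
apply: (@runsA_seq _ _ _ _ true T (h + n) _ _ _ 1) IHn; rewrite addnS.
by move=> J t ht; exists (mv DR (tc t) t); [apply: at_bwd | apply: runs_act].
Qed.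

(** A stride of [B] cells stays on the same cell of successive blocks. A mark makes [read1] exit
    with true, which [ret false] turns into the exit of the loop. *)
Definition seek d B := loop (ite read1 (ret false) (goN d B)).

Lemma runsA_seekL B T h n :
  T (h + n * B) = Some T1 -> (forall i, i < n -> T (h + i * B) != Some T1) ->
  runsA (seek DL B) T h false T (h + n * B) (n.+1 * (B + 2)).
Proof.
elim: n h => [|n IHn] h hT hF.
  rewrite mul0n addn0 in hT *; apply: (@runsA_le _ _ _ _ _ _ 2); first lia.
  apply: runsA_loop_stop; apply: (@runsA_ite _ _ _ _ _ true _ _ _ _ _ 1 1).
    by have := @runsA_read1 T h; rewrite hT eqxx; apply.
  exact: runsA_ret.
have -> : n.+2 * (B + 2) = (1 + B.+1) + n.+1 * (B + 2) by lia.
apply: (@runsA_loop_next _ _ _ T (h + B)).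
  apply: (@runsA_ite _ _ _ _ _ false T h _ _ _ 1); last exact: runsA_goL.
  have := @runsA_read1 T h; have := hF 0; rewrite addn0; case: eqP => //; lia.
rewrite mulSn addnA in hT *; apply: IHn => // i hi.
by have := hF i.+1; rewrite mulSn addnA; apply.
Qed.

Lemma runsA_seekR B T h n :
  T h = Some T1 -> (forall i, i < n -> T (h + i.+1 * B) != Some T1) ->
  runsA (seek DR B) T (h + n * B) false T h (n.+1 * (B + 2)).
Proof.
elim: n => [|n IHn] hT hF.
  rewrite mul0n addn0 in hT *; apply: (@runsA_le _ _ _ _ _ _ 2); first lia.
  apply: runsA_loop_stop; apply: (@runsA_ite _ _ _ _ _ true _ _ _ _ _ 1 1).
    by have := @runsA_read1 T h; rewrite hT eqxx; apply.
  exact: runsA_ret.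
have -> : n.+2 * (B + 2) = (1 + B.+1) + n.+1 * (B + 2) by lia.
apply: (@runsA_loop_next _ _ _ T (h + n * B)).
  apply: (@runsA_ite _ _ _ _ _ false T (h + n.+1 * B) _ _ _ 1).
    have := @runsA_read1 T (h + n.+1 * B); have := hF n; case: eqP => //; lia.
  by rewrite mulSn [B + _]addnC addnA; apply: runsA_goR.
by apply: IHn => // i hi; apply: hF; lia.
Qed.

(** * Cells of a tape divided into blocks *)

(** Only [T1] is bit 1, so both the blank and the [T0] written by the input phase read as 0. *)
Definition repr_cells B (c : nat -> nat -> bool) (T : nat -> sym) : Prop :=
  forall i r, r < B -> (T (i * B + r) == Some T1) = c r i.

Definition runsC B M c r c' n : Prop :=
  forall T, repr_cells B c T -> exists2 T', repr_cells B c' T' & runsA M T 0 r T' 0 n.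

Definition find B r := seqm (goN DL r) (seek DL B).
Definition back B r := seqm (goN DR r) (seek DR B).

Lemma repr_upd B c T r i v : repr_cells B c T -> r < B ->
  repr_cells B (fun r' i' => if (r' == r) && (i' == i) then v else c r' i')
       (upd T (i * B + r) (if v then Some T1 else None)).
Proof.
move=> hT hr i' r' hr'; rewrite /upd.
have -> : (i' * B + r' == i * B + r) = (r' == r) && (i' == i).
  apply/eqP/andP => [e|[/eqP -> /eqP ->] //].
  have : (i' * B + r') %/ B = (i * B + r) %/ B by rewrite e.
  have : (i' * B + r') %% B = (i * B + r) %% B by rewrite e.
  rewrite !modnMDl !modn_small // => ->.
  by rewrite !divnMDl ?divn_small ?addn0 // => [->||]; rewrite ?eqxx //; lia.
by case: ifP => _; [case: v | rewrite hT].
Qed.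

Lemma runsC_le B M c r c' n n' : n <= n' -> runsC B M c r c' n -> runsC B M c r c' n'.
Proof. by move=> h hM T /hM [T' hT' ?]; exists T' => //; apply: runsA_le h _. Qed.

Lemma runsC_ext B M c r c' c'' n : (forall r i, r < B -> c' r i = c'' r i) ->
  runsC B M c r c' n -> runsC B M c r c'' n.
Proof.
by move=> e hM T /hM [T' hT' ?]; exists T' => // i r' h; rewrite hT' ?e.
Qed.

Lemma runsC_ite B C M1 M2 c r c' r' c'' n m :
  runsC B C c r c' n -> runsC B (if r then M1 else M2) c' r' c'' m ->
  runsC B (ite C M1 M2) c r' c'' (n + m).
Proof.
move=> hC hM T /hC [T' /hM [T'' hT'' h2] h1]; exists T'' => //.
exact: runsA_ite h1 h2.
Qed.

Lemma runsC_seq B M1 M2 c r c' r' c'' n m :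
  runsC B M1 c r c' n -> runsC B M2 c' r' c'' m ->
  runsC B (seqm M1 M2) c r' c'' (n + m).
Proof. by move=> h1 h2; apply: runsC_ite h1 _; case: r. Qed.

Lemma runsC_loop_stop B M c c' n : runsC B M c false c' n -> runsC B (loop M) c false c' n.
Proof. by move=> hM T /hM [T' hT' h]; exists T' => //; apply: runsA_loop_stop. Qed.

Lemma runsC_loop_next B M c c' c'' n m :
  runsC B M c true c' n -> runsC B (loop M) c' false c'' m ->
  runsC B (loop M) c false c'' (n + m).
Proof.
move=> hC hM T /hC [T' /hM [T'' hT'' h2] h1]; exists T'' => //.
exact: runsA_loop_next h1 h2.
Qed.

Lemma runsC_ret B b c : runsC B (ret b) c b c 1.
Proof. by move=> T hT; exists T => //; apply: runsA_ret. Qed.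

(** This is the mark of head [0], the only landmark by which [back] recognises block [0]. Every
    write therefore has to spare cell [0], whence the condition [0 < r] in the lemmas on writing. *)
Definition origin (c : nat -> nat -> bool) := forall i, c 0 i = (i == 0).

Lemma runsA_find B c T r i : repr_cells B c T -> r < B -> (forall j, c r j = (i == j)) ->
  runsA (find B r) T 0 false T (i * B + r) (i.+2 * (B + 2)).
Proof.
move=> hT hr hc; apply: (@runsA_le _ _ _ _ _ _ (r.+1 + i.+1 * (B + 2))); first lia.
apply: (@runsA_seq _ _ _ _ true T r); first exact: runsA_goL.
rewrite [i * B + r]addnC; apply: runsA_seekL.
  by apply/eqP; rewrite addnC hT // hc eqxx.
by move=> j hj; rewrite addnC hT // hc; case: eqP => //; lia.
Qed.

Lemma runsA_back B c T r i : repr_cells B c T -> origin c -> r < B ->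
  runsA (back B r) T (i * B + r) false T 0 (i.+2 * (B + 2)).
Proof.
move=> hT h0 hr; apply: (@runsA_le _ _ _ _ _ _ (r.+1 + i.+1 * (B + 2))); first lia.
apply: (@runsA_seq _ _ _ _ true T (i * B)); first exact: runsA_goR.
apply: (@runsA_seekR _ _ 0).
  by apply/eqP; have := hT 0 0; rewrite mul0n addn0 => ->; rewrite ?h0 //; lia.
move=> j hj; rewrite add0n -(addn0 (_ * B)) hT ?h0 //; lia.
Qed.

Definition move_track r r' := seqm (goN DR r) (goN DL r').

Lemma runsA_move B T r r' i : r < B -> r' < B ->
  runsA (move_track r r') T (i * B + r) true T (i * B + r') (2 * (B + 2)).
Proof.
move=> hr hr'; apply: (@runsA_le _ _ _ _ _ _ (r.+1 + r'.+1)); first lia.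
apply: (@runsA_seq _ _ _ _ true T (i * B)); [exact: runsA_goR | exact: runsA_goL].
Qed.

Definition test B r r' :=
  seqm (find B r) (seqm (move_track r r')
    (ite read1 (seqm (back B r') (ret true)) (seqm (back B r') (ret false)))).

Lemma runsC_test B c r r' i : origin c -> r < B -> r' < B ->
  (forall j, c r j = (i == j)) ->
  runsC B (test B r r') c (c r' i) c (4 * (i.+2 * (B + 2))).
Proof.
move=> h0 hr hr' hc T hT; exists T => //.
apply: (@runsA_le _ _ _ _ _ _ (i.+2 * (B + 2) + (2 * (B + 2) + (1 + (i.+2 * (B + 2) + 1))))).
  by lia.
apply: (runsA_seq (runsA_find hT hr hc)).
apply: runsA_seq; first exact: (runsA_move hr hr').
apply: runsA_ite; first exact: runsA_read1.
rewrite hT //; case: (c r' i); apply: (runsA_seq (runsA_back hT h0 hr')); exact: runsA_ret.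
Qed.

(* Blank is the bit 0, so that the blocks never written to hold no mark. *)
Definition bit_sym (v : bool) : sym := if v then Some T1 else None.

Definition put B r r' v :=
  seqm (find B r) (seqm (move_track r r') (seqm (wr (bit_sym v)) (back B r'))).

Definition updC (c : nat -> nat -> bool) r i v : nat -> nat -> bool :=
  fun r' i' => if (r' == r) && (i' == i) then v else c r' i'.

Lemma origin_updC c r i v : origin c -> 0 < r -> origin (updC c r i v).
Proof. by move=> h0 hr j; rewrite /updC; case: eqP => [|_]; [lia | exact: h0]. Qed.

Lemma runsC_put B c r r' v i : origin c -> r < B -> 0 < r' < B ->
  (forall j, c r j = (i == j)) ->
  runsC B (put B r r' v) c false (updC c r' i v) (4 * (i.+2 * (B + 2))).
Proof.
move=> h0 hr /andP[hr0 hr'] hc T hT.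
have hT' := repr_upd i v hT hr'; eexists; first exact: hT'.
apply: (@runsA_le _ _ _ _ _ _ (i.+2 * (B + 2) + (2 * (B + 2) + (1 + i.+2 * (B + 2))))).
  by lia.
apply: (runsA_seq (runsA_find hT hr hc)).
apply: runsA_seq; first exact: (runsA_move hr hr').
apply: runsA_seq; first exact: runsA_wr.
exact: runsA_back hT' (origin_updC _ _ h0 hr0) hr'.
Qed.

Definition advance B r :=
  seqm (find B r) (seqm (wr None) (seqm (goN DL B) (seqm (wr (Some T1)) (back B r)))).

Lemma runsC_advance B c r i : origin c -> 0 < r < B ->
  (forall j, c r j = (i == j)) ->
  runsC B (advance B r) c false
    (fun x j => if x == r then i.+1 == j else c x j) (5 * (i.+2 * (B + 2))).
Proof.
move=> h0 /andP[hr0 hr] hc T hT.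
have hT1 := repr_upd i false hT hr; have hT2 := repr_upd i.+1 true hT1 hr.
exists (upd (upd T (i * B + r) None) (i.+1 * B + r) (Some T1)).
  move=> j x hx; rewrite hT2 //; case: (x =P r) => //= ->; rewrite hc.
  by case: eqP => [->|]; rewrite ?eqxx //; case: eqP => //; lia.
apply: (@runsA_le _ _ _ _ _ _ (i.+2 * (B + 2) + (1 + (B.+1 + (1 + i.+3 * (B + 2)))))).
  by lia.
apply: (runsA_seq (runsA_find hT hr hc)).
apply: runsA_seq; first exact: runsA_wr.
apply: runsA_seq; first exact: runsA_goL.
have -> : i * B + r + B = i.+1 * B + r by lia.
apply: runsA_seq; first exact: runsA_wr.
apply: runsA_back hT2 _ hr.
by move=> j; case: eqP => [|_]; [lia | exact: h0].
Qed.

(** * Loop programs and their compilation *)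

Record state := State { pos : nat -> nat; trk : nat -> nat -> bool }.

(* [If h c a b] tests cell [c] of the block under head [h], where [c] is the code of
   a head ([head_cell]) or of a track ([track_cell]).  Head [0] stays on block [0], head [1] on the
   block following the input; [For h b] runs [b] with [h] on each block up to it. *)
Inductive cmd :=
| Skip
| Sq (a b : cmd)
| If (h c : nat) (a b : cmd)
| Put (h k : nat) (v : bool)
| Right (h : nat)
| Copy (h h' : nat)
| For (h : nat) (b : cmd).

Notation "a ;; b" := (Sq a b) (at level 60, right associativity).

(** Heads and tracks alternate within a block: both are numbered from 0, and a block of [W.*2] cells
    has room for [W] of each. *)
Definition head_cell (h : nat) := h.*2.
Definition track_cell (k : nat) := k.*2.+1.

Definition cell st c i := if odd c then trk st c./2 i else pos st c./2 == i.

Lemma cell_hd st h i : cell st (head_cell h) i = (pos st h == i).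
Proof. by rewrite /cell /head_cell odd_double doubleK. Qed.

Lemma cell_tr st k i : cell st (track_cell k) i = trk st k i.
Proof. by rewrite /cell /track_cell /= odd_double uphalf_double. Qed.

Definition setp st h i := State (upd (pos st) h i) (trk st).

(** Locked so that simplification does not unroll loops. *)
Definition upto n := locked (iota 0 n.+1).
Lemma uptoE n : upto n = iota 0 n.+1. Proof. by rewrite /upto -lock. Qed.

Fixpoint sem p st : state :=
  match p with
  | Skip => st
  | Sq a b => sem b (sem a st)
  | If h c a b => if cell st c (pos st h) then sem a st else sem b st
  | Put h k v => State (pos st) (updC (trk st) k (pos st h) v)
  | Right h => setp st h (pos st h).+1
  | Copy h h' => setp st h (pos st h')
  | For h b => foldl (fun s i => sem b (setp s h i)) st (upto (pos st 1))
  end.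

(** An upper bound on the number of elementary operations, [N] being the position of head [1]; a
    test is charged for both branches. In a loop, the first 2 pays for resetting the head by a copy,
    the second for the test and the advance of each round. *)
Fixpoint ops p N : nat :=
  match p with
  | Sq a b => ops a N + ops b N
  | If _ _ a b => (ops a N + ops b N).+1
  | Copy _ _ => 2
  | For _ b => 2 + N.+1 * (ops b N + 2)
  | _ => 1
  end.

Fixpoint mod_heads p : seq nat :=
  match p with
  | Sq a b | If _ _ a b => mod_heads a ++ mod_heads b
  | Right h | Copy h _ => [:: h]
  | For h b => h :: mod_heads b
  | _ => [::]
  end.

Fixpoint mod_tracks p : seq nat :=
  match p with
  | Sq a b | If _ _ a b => mod_tracks a ++ mod_tracks b
  | Put _ k _ => [:: k]
  | For _ b => mod_tracks b
  | _ => [::]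
  end.

(** Head [0] is the way back and head [1] bounds all loops, so neither may move. A loop body must
    not move the head of its loop, because the machine advances that head from where it stands,
    whereas [sem] sets it afresh to the index. *)
Fixpoint wf W p : bool :=
  match p with
  | Skip => true
  | Sq a b => wf W a && wf W b
  | If h c a b => [&& h < W, c < W.*2, wf W a & wf W b]
  | Put h k _ => (h < W) && (k < W)
  | Right h => 1 < h < W
  | Copy h h' => (1 < h < W) && (h' < W)
  | For h b => [&& 1 < h < W, h \notin mod_heads b & wf W b]
  end.

Lemma sem_mod_heads p st h : h \notin mod_heads p -> pos (sem p st) h = pos st h.
Proof.
elim: p st => //= [a IHa b IHb|h' c a IHa b IHb|h'|h' h''|h' b IHb] st.
- by rewrite mem_cat => /norP[ha hb]; rewrite IHb ?IHa.
- by rewrite mem_cat => /norP[ha hb]; case: ifP; rewrite ?IHb ?IHa.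
- by rewrite inE /upd => /negbTE ->.
- by rewrite inE /upd => /negbTE ->.
rewrite inE => /norP[/negbTE hh hb].
by move: (upto _) => l0; elim: l0 st => //= i l IHl st; rewrite IHl IHb //= /upd hh.
Qed.

Lemma sem_mod_tracks p st k : k \notin mod_tracks p -> trk (sem p st) k = trk st k.
Proof.
elim: p st => //= [a IHa b IHb|h' c a IHa b IHb|h k' v|h' b IHb] st.
- by rewrite mem_cat => /norP[ha hb]; rewrite IHb ?IHa.
- by rewrite mem_cat => /norP[ha hb]; case: ifP; rewrite ?IHb ?IHa.
- by rewrite inE /updC => /negbTE ->.
by move=> hb; move: (upto _) => l0; elim: l0 st => //= i l IHl st; rewrite IHl IHb.
Qed.

Lemma wf_mod_heads W p h : wf W p -> h < 2 -> h \notin mod_heads p.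
Proof.
elim: p => //= [a IHa b IHb|h' c a IHa b IHb|h'|h' h''|h' b IHb].
- by case/andP => wa wb hh; rewrite mem_cat negb_or IHa ?IHb.
- by case/and4P => _ _ wa wb hh; rewrite mem_cat negb_or IHa ?IHb.
- by rewrite inE; lia.
- by rewrite inE; lia.
by case/and3P => ? _ wb hh; rewrite inE negb_or IHb // andbT; lia.
Qed.

(** One operation takes a head at most one block beyond the furthest head. This bounds the length of
    every sweep of the compiled machine. *)
Lemma pos_sem W p st E : wf W p -> (forall h, pos st h <= E) ->
  forall h, pos (sem p st) h <= E + ops p (pos st 1).
Proof.
elim: p st E => //= [|a IHa b IHb|h' c a IHa b IHb|h k v|h'|h' h''|h' b IHb] st E.
- by move=> _ hE h; have := hE h; lia.
- case/andP => wa wb hE h; rewrite addnA -(sem_mod_heads _ (wf_mod_heads wa (ltnSn 1))).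
  by apply: IHb => // h'; rewrite (sem_mod_heads _ (wf_mod_heads wa (ltnSn 1))); apply: IHa.
- case/and4P => _ _ wa wb hE h; case: ifP => _.
    by have := IHa _ _ wa hE h; lia.
  by have := IHb _ _ wb hE h; lia.
- by move=> _ hE h'; have := hE h'; lia.
- by move=> _ hE h; rewrite /upd; have := hE h; have := hE h'; case: eqP; lia.
- by move=> _ hE h; rewrite /upd; have := hE h; have := hE h''; case: eqP; lia.
case/and3P => w1 _ wb hE h.
have hN : pos st 1 <= E by [].
have le_upto : all (fun i => i <= pos st 1) (upto (pos st 1)).
  by apply/allP => i; rewrite uptoE mem_iota; lia.
suff : pos (foldl (fun s i => sem b (setp s h' i)) st (upto (pos st 1))) h
    <= E + size (upto (pos st 1)) * (ops b (pos st 1) + 2).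
  by rewrite uptoE size_iota; lia.
move eN: (pos st 1) le_upto hN => N; move: (upto N) => l hl hN.
elim: l st E hE eN hN hl => [|i l IHl] st E hE eN hN /=; first by have := hE h; lia.
case/andP=> hi hl; have e1 : pos (setp st h' i) 1 = N by rewrite /= /upd; case: eqP; lia.
have eN' : pos (sem b (setp st h' i)) 1 = N by rewrite (sem_mod_heads _ (wf_mod_heads wb _)).
apply: leq_trans (IHl _ (E + ops b N) _ eN' _ hl) _; [|lia|rewrite mulSn; lia].
move=> h0; rewrite -e1; apply: IHb => // h1; rewrite /= /upd.
by case: ifP => _ //; lia.
Qed.

(** For [h = h'] the general code would erase the very mark it has to find next. *)
Definition copy B h h' : mach :=
  if h == h' then ret true else seqm (put B (head_cell h) (head_cell h) false) (put B (head_cell h') (head_cell h) true).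

Fixpoint compile B p : mach :=
  match p with
  | Skip => ret true
  | Sq a b => seqm (compile B a) (compile B b)
  | If h c a b => ite (test B (head_cell h) c) (compile B a) (compile B b)
  | Put h k v => put B (head_cell h) (track_cell k) v
  | Right h => advance B (head_cell h)
  | Copy h h' => copy B h h'
  | For h b => seqm (copy B h 0) (loop (seqm (compile B b)
      (ite (test B (head_cell h) (head_cell 1)) (ret false) (seqm (advance B (head_cell h)) (ret true)))))
  end.

(** The dearest single sweep operation is [advance], with factor 5; the sixth unit pays for the
    isolated steps in between. [M] bounds all head positions. *)
Definition unit_cost B M := 6 * (M.+2 * (B + 2)).

Lemma unit_cost_pos B M : 6 <= unit_cost B M. Proof. rewrite /unit_cost; lia. Qed.

Lemma runs_copy W st h h' M : 1 < h < W -> h' < W -> pos st 0 = 0 ->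
  (forall x, pos st x <= M) ->
  exists r, runsC W.*2 (copy W.*2 h h') (cell st) r (cell (setp st h (pos st h')))
     (unit_cost W.*2 M * 2).
Proof.
move=> hh hh' h0 hM; rewrite /copy; case: eqP => [->|ne].
  exists true; apply: (@runsC_le _ _ _ _ _ 1); first by have := unit_cost_pos W.*2 M; lia.
  apply: (@runsC_ext _ _ _ _ (cell st)); last exact: runsC_ret.
  move=> x i _.
  by rewrite /cell /setp /upd /=; case: ifP => // _; case: (x./2 =P h') => [->|].
have o0 : origin (cell st) by move=> i; rewrite /cell /= h0 eq_sym.
exists false; apply: (@runsC_ext _ _ _ _
   (updC (updC (cell st) (head_cell h) (pos st h) false) (head_cell h) (pos st h') true)).
  move=> x i _; rewrite /updC; case: (x =P head_cell h) => [->|nx] /=.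
    by rewrite !cell_hd /= /upd eqxx; do 2![case: eqP => //]; lia.
  rewrite /cell /= /upd; case: ifP => // ox; case: (x./2 =P h) => // ex.
  by case: nx; rewrite /head_cell -ex -[LHS]odd_double_half ox.
have := hM h; have := hM h'; set i := pos st h; set j := pos st h' => hj hi.
apply: (@runsC_le _ _ _ _ _ (4 * (i.+2 * (W.*2 + 2)) + 4 * (j.+2 * (W.*2 + 2)))).
  by rewrite /unit_cost; nia.
have hb x : x < W -> head_cell x < W.*2 by rewrite /head_cell; lia.
have hB : 0 < head_cell h < W.*2 by rewrite /head_cell; lia.
apply: runsC_seq.
  by apply: runsC_put => //; [apply: hb; lia | move=> y; apply: cell_hd].
apply: runsC_put => //; [by apply: origin_updC o0 _; lia | exact: hb|].
move=> y; rewrite /updC cell_hd; case: eqP => // e; case: ne; move: e; rewrite /head_cell; lia.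
Qed.

Theorem runs_comp W p st E M : 1 < W -> wf W p -> pos st 0 = 0 ->
  (forall h, pos st h <= E) -> E + ops p (pos st 1) <= M ->
  exists r, runsC W.*2 (compile W.*2 p) (cell st) r (cell (sem p st))
    (unit_cost W.*2 M * ops p (pos st 1)).
Proof.
move=> W1.
have hb x : x < W -> head_cell x < W.*2 by rewrite /head_cell; lia.
have hcost i : i <= M -> 5 * (i.+2 * (W.*2 + 2)) < unit_cost W.*2 M.
  by rewrite /unit_cost; nia.
have u6 := unit_cost_pos W.*2 M.
have or0 s : pos s 0 = 0 -> origin (cell s) by move=> e i; rewrite /cell /= e eq_sym.
elim: p st E => [|a IHa b IHb|h c a IHa b IHb|h k v|h|h h'|h b IHb] st E wp h0 hE hM /=.
- by exists true; apply: (@runsC_le _ _ _ _ _ 1); [lia | exact: runsC_ret].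
- move: wp hM => /= /andP[wa wb] hM.
  have [ra Ra] := IHa _ E wa h0 hE ltac:(lia).
  have e1 : pos (sem a st) 1 = pos st 1 by rewrite (sem_mod_heads _ (wf_mod_heads wa _)).
  have e0 : pos (sem a st) 0 = 0 by rewrite (sem_mod_heads _ (wf_mod_heads wa _)).
  have [|rb Rb] := IHb (sem a st) _ wb e0 (pos_sem wa hE); first by rewrite e1; lia.
  by rewrite e1 in Rb; exists rb; rewrite mulnDr; apply: runsC_seq Ra Rb.
- case/and4P: wp => wh wc wa wb; move: hM => /= hM.
  have [ra Ra] := IHa _ E wa h0 hE ltac:(lia).
  have [rb Rb] := IHb _ E wb h0 hE ltac:(lia).
  have RC := runsC_test (or0 _ h0) (hb _ wh) wc (cell_hd st h).
  have := hcost (pos st h); have := hE h; move: RC.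
  case: (cell st c (pos st h)) => RC hh cc; [exists ra | exists rb].
    apply: (@runsC_le _ _ _ _ _ (4 * ((pos st h).+2 * (W.*2 + 2)) +
       unit_cost W.*2 M * ops a (pos st 1))); [lia | exact: runsC_ite RC Ra].
  apply: (@runsC_le _ _ _ _ _ (4 * ((pos st h).+2 * (W.*2 + 2)) +
     unit_cost W.*2 M * ops b (pos st 1))); [lia | exact: runsC_ite RC Rb].
- case/andP: wp => wh wk; exists false.
  apply: (@runsC_le _ _ _ _ _ (4 * ((pos st h).+2 * (W.*2 + 2)))).
    by have := hcost (pos st h); have := hE h; lia.
  apply: (@runsC_ext _ _ _ _ (updC (cell st) (track_cell k) (pos st h) v)).
    move=> x i _; rewrite /updC; case: (x =P track_cell k) => [->|nx] /=.
      by rewrite !cell_tr /= /updC eqxx.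
    rewrite /cell /= /updC; case: ifP => // ox; case: (x./2 =P k) => // ex.
    by case: nx; rewrite /track_cell -ex -[LHS]odd_double_half ox.
  by apply: runsC_put; rewrite ?hb //; [exact: or0 | rewrite /track_cell; lia | exact: cell_hd].
- exists false; have hp : 0 < head_cell h < W.*2 by move: wp; rewrite /= /head_cell; lia.
  apply: (@runsC_le _ _ _ _ _ (5 * ((pos st h).+2 * (W.*2 + 2)))).
    by have := hcost (pos st h); have := hE h; lia.
  apply: runsC_ext (runsC_advance (or0 _ h0) hp (cell_hd st h)).
  move=> x i _; case: (x =P head_cell h) => [->|nx]; first by rewrite cell_hd /= /upd eqxx.
  rewrite /cell /= /upd; case: ifP => // ox; case: (x./2 =P h) => // ex.
  by case: nx; rewrite /head_cell -ex -[LHS]odd_double_half ox.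
- case/andP: wp => wh wh'; apply: runs_copy => // x; have := hE x; lia.
case/and3P: wp => wh nh wb; move: hM => /=; move eN: (pos st 1) => N hM.
have hN : N <= E by rewrite -eN.
pose st0 := setp st h 0.
have [rc Rc] : exists r, runsC W.*2 (copy W.*2 h 0) (cell st) r (cell st0)
     (unit_cost W.*2 M * 2).
  have := @runs_copy W st h 0 M wh; rewrite h0; apply=> // [|x]; [lia | have := hE x; lia].
exists false; rewrite mulnDr; apply: runsC_seq Rc _.
rewrite uptoE; have h2 : 0 < head_cell h < W.*2 by rewrite /head_cell; lia.
set L := loop _.
(* Generalised over the number [d] of rounds left after the current one, and over the bound [F] on
   the heads, which grows by [ops b N] in each round. *)
suff key d i s F : i + d = N -> pos s 0 = 0 -> (forall x, pos s x <= F) ->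
  pos s 1 = N -> N <= F -> F + d.+1 * (ops b N + 2) <= M ->
  runsC W.*2 L (cell (setp s h i)) false
    (cell (foldl (fun s i => sem b (setp s h i)) s (iota i d.+1)))
    (unit_cost W.*2 M * (d.+1 * (ops b N + 2))).
  by apply: (key _ _ _ E) => //; lia.
elim: d i s F => [|d IHd] i s F ei s0 hF sN NF hF'.
all: have e0 : pos (setp s h i) 0 = 0 by rewrite /= /upd; case: eqP; lia.
all: have e1 : pos (setp s h i) 1 = N by rewrite /= /upd; case: eqP; lia.
all: have hFi x : pos (setp s h i) x <= F by rewrite /= /upd; case: eqP; have := hF x; lia.
all: have [|rb] := IHb (setp s h i) F wb e0 hFi; first by rewrite e1; lia.
all: have hF2 := pos_sem wb hFi; rewrite e1 in hF2 *.
all: set s' := sem b _ in hF2 * => Rb.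
all: have e0' : pos s' 0 = 0 by rewrite (sem_mod_heads _ (wf_mod_heads wb _)).
all: have e1' : pos s' 1 = N by rewrite (sem_mod_heads _ (wf_mod_heads wb _)).
all: have eh : pos s' h = i by rewrite (sem_mod_heads _ nh) /= /upd eqxx.
all: have RT := runsC_test (r' := head_cell 1) (or0 _ e0') (hb _ (_ : h < W)) (hb 1 W1) (cell_hd s' h).
all: rewrite eh cell_hd e1' in RT.
(* In the last round the mark of head [1] lies in the block of [h], and the test leaves the loop. *)
- have eq : (N == i) = true by apply/eqP; lia.
  have {}RT := RT ltac:(lia); rewrite eq in RT; apply: runsC_loop_stop.
  apply: (@runsC_le _ _ _ _ _ (unit_cost W.*2 M * ops b N + (4 * (i.+2 * (W.*2 + 2)) + 1))).
    by have := hcost i; lia.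
  by apply: (runsC_seq Rb); apply: (runsC_ite RT); apply: runsC_ret.
have eq : (N == i) = false by apply/eqP; lia.
have {}RT := RT ltac:(lia); rewrite eq in RT.
apply: (@runsC_le _ _ _ _ _ ((unit_cost W.*2 M * ops b N + (4 * (i.+2 * (W.*2 + 2)) +
   (5 * (i.+2 * (W.*2 + 2)) + 1))) + unit_cost W.*2 M * (d.+1 * (ops b N + 2)))).
  by have := hcost i; rewrite [d.+2 * _]mulSn; lia.
apply: (@runsC_loop_next _ _ _ (cell (setp s' h i.+1))).
  apply: (runsC_seq Rb); apply: (runsC_ite RT); apply: runsC_seq; last exact: runsC_ret.
  have := runsC_advance (or0 _ e0') h2 (cell_hd s' h); rewrite eh; apply: runsC_ext.
  move=> x j _; case: (x =P head_cell h) => [->|nx]; first by rewrite cell_hd /= /upd eqxx.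
  rewrite /cell /= /upd; case: ifP => // ox; case: (x./2 =P h) => // ex.
  by case: nx; rewrite /head_cell -ex -[LHS]odd_double_half ox.
apply: (IHd _ _ (F + ops b N)) => //; lia.
Qed.

(** * Polynomial time and the input phase *)

(** The base [n.+1] is positive, so exponents may be raised when two bounds are added. *)
Definition polyb (f : nat -> nat) := exists c d, forall n, f n <= c * n.+1 ^ d.

Lemma polyb_const a : polyb (fun=> a).
Proof. by exists a, 0 => n; rewrite expn0 muln1. Qed.

Lemma polyb_id : polyb (fun n => n).
Proof. by exists 1, 1 => n; rewrite expn1 mul1n. Qed.

Lemma polyb_add f g : polyb f -> polyb g -> polyb (fun n => f n + g n).
Proof.
move=> [c [d hf]] [c' [d' hg]]; exists (c + c'), (d + d') => n.
rewrite mulnDl leq_add //; [apply: leq_trans (hf n) _ | apply: leq_trans (hg n) _];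
  by rewrite leq_mul2l leq_pexp2l ?orbT ?leq_addr ?leq_addl.
Qed.

Lemma polyb_mul f g : polyb f -> polyb g -> polyb (fun n => f n * g n).
Proof.
move=> [c [d hf]] [c' [d' hg]]; exists (c * c'), (d + d') => n.
by rewrite expnD mulnACA leq_mul.
Qed.

Lemma polyb_S f : polyb f -> polyb (fun n => (f n).+1).
Proof.
move=> hf; have [c [d h]] := polyb_add hf (polyb_const 1).
by exists c, d => n; rewrite -addn1.
Qed.

Lemma polyb_ops p : polyb (ops p).
Proof.
elim: p => /= [|a IHa b IHb|h c a IHa b IHb|h k v|h|h h'|h b IHb]; try exact: polyb_const.
- exact: polyb_add.
- by apply: polyb_S; apply: polyb_add.
apply: polyb_add; first exact: polyb_const.
apply: polyb_mul; first exact: polyb_S polyb_id.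
by apply: polyb_add => //; apply: polyb_const.
Qed.

(** * Two-exit machines as deciding Turing machines *)

Section TMOfMach.
Variable M : mach.
Local Notation Q := (option (mst M + bool)).

(* State [None] is entered when the machine exits; it reads the answer. *)
Definition tmM_delta (q : 'I_#|{: Q}|) (x : sym) : option ('I_#|{: Q}| * sym * dir) :=
  match enum_val q with
  | Some (inl m) => let: (y, s, d) := mdelta m x in
      Some (enum_rank (if y is inl m' then Some (inl m') else None : Q), s, d)
  | None => Some (enum_rank (Some (inr (x == Some T1)) : Q), x, DS)
  | Some (inr _) => None
  end.

Definition tmM : TM :=
  {| tm_n := #|{: Q}|;
     tm_start := enum_rank (Some (inl (mstart M)) : Q);
     tm_delta := tmM_delta;
     tm_acc := fun q => if enum_val q is Some (inr b) then b else false |}.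

Definition tmM_conf (q : Q) (t : tape) : tconf tmM :=
  @TConf tmM (enum_rank q) (tl t) (tc t) (tr t).

Lemma tmM_reach n x t r t' : reach n x t r t' ->
  tm_run n (tmM_conf (Some (inl x)) t) = tmM_conf None t'.
Proof.
elim: n x t => // n IHn x t; rewrite /tm_run iterSr {2}/tm_step /= /tmM_delta enum_rankK.
case: mdelta => [[[y|b] s] d]; first by case: d => /IHn.
by case=> -> _ <-; case: d.
Qed.

Definition in_tape (w : seq tk) := Tape [::] (head None (map Some w)) (behead (map Some w)).

Lemma tmM_answers w r t' n n' : n < n' -> runs M (in_tape w) r t' n ->
  tm_answers_within tmM w n' (tc t' == Some T1).
Proof.
move=> ltn [m le_m h]; rewrite /tm_answers_within.
(* There are [m] steps up to the exit, one step to read the answer, and idling in the halted state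
   for the rest. *)
have -> : n' = (n' - m.+1) + (1 + m) by lia.
rewrite /tm_run !iterD -[tm_init _ _]/(tmM_conf (Some (inl (mstart M))) (in_tape w)).
rewrite -/(tm_run m _) (tmM_reach h) /= /tm_step /= /tmM_delta enum_rankK.
set c := TConf _ _ _ _; have hc : tm_delta (tc_st c) (tc_cur c) = None.
  by rewrite /= /tmM_delta enum_rankK.
have -> k : iter k (@tm_step tmM) c = c by elim: k => // k /= ->; rewrite /tm_step hc.
by rewrite /tm_halted hc /= enum_rankK eqxx.
Qed.
End TMOfMach.

(** * Copying the input into blocks *)

Definition walk d := loop (act (fun x => (x, if x is None then DS else d, x != None))).
Fixpoint writeL (l : seq sym) :=
  if l is s :: l' then seqm (act (fun _ => (s, DL, true))) (writeL l') else ret true.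

Definition blank (l : seq sym) := all (pred1 None) l.
Definition nonblank (l : seq sym) := all (predC1 None) l.

Lemma nonblank_cat l l' : nonblank (l ++ l') = nonblank l && nonblank l'.
Proof. exact: all_cat. Qed.

Lemma nonblank_rev l : nonblank (rev l) = nonblank l.
Proof. exact: all_rev. Qed.

Lemma runs_walkL l Z r : nonblank l -> head None Z = None ->
  runs (walk DL) (Tape (behead (l ++ Z)) (head None (l ++ Z)) r) false
    (Tape (behead Z) None (rev l ++ r)) (size l).+1.
Proof.
elim: l r => [|x l IHl] r /= => [_ e|/andP[nx nl] e].
  by rewrite e; apply: runs_loop_stop; apply: (@runs_act _ _ None DS).
rewrite -[(size l).+2]add1n rev_cons cat_rcons.
apply: runs_loop_next (IHl _ nl e).
have /= := @runs_act (fun x => (x, if x is None then DS else DL, x != None))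
  (Tape (l ++ Z) x r) _ _ _ erefl.
by case: x nx.
Qed.

Lemma runs_walkR l Z r : nonblank l -> head None Z = None ->
  runs (walk DR) (Tape r (head None (l ++ Z)) (behead (l ++ Z))) false
    (Tape (rev l ++ r) None (behead Z)) (size l).+1.
Proof.
elim: l r => [|x l IHl] r /= => [_ e|/andP[nx nl] e].
  by rewrite e; apply: runs_loop_stop; apply: (@runs_act _ _ None DS).
rewrite -[(size l).+2]add1n rev_cons cat_rcons.
apply: runs_loop_next (IHl _ nl e).
have /= := @runs_act (fun x => (x, if x is None then DS else DR, x != None))
  (Tape r x (l ++ Z)) _ _ _ erefl.
by case: x nx.
Qed.

Lemma blank_head Z : blank Z -> head None Z = None.
Proof. by case: Z => //= x Z /andP[/eqP]. Qed.

Lemma blank_behead Z : blank Z -> blank (behead Z).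
Proof. by case: Z => //= x Z /andP[]. Qed.

Lemma runs_writeL l Z r : blank Z -> exists2 Z', blank Z' &
  runs (writeL l) (Tape Z None r) true (Tape Z' None (rev l ++ r)) (size l).+1.
Proof.
elim: l Z r => [|s l IHl] Z r bZ /=; first by exists Z => //; apply: runs_ret.
have [Z' bZ' h] := IHl _ (s :: r) (blank_behead bZ).
exists Z' => //; rewrite rev_cons cat_rcons -[(size l).+2]add1n.
have := @runs_act (fun _ => (s, DL, true)) (Tape Z None r) s DL true erefl.
by rewrite /= (blank_head bZ) => h1; apply: runs_seq h1 h.
Qed.

(* The blank left in the input is the place to come back to: the cells between it and
   the end of the last block are nonblank. *)
Definition copy_cell (l : seq sym) :=
  seqm (act (fun _ => (None, DL, true))) (seqm (walk DL) (seqm (writeL l)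
    (seqm (go DR) (seqm (walk DR) (act (fun _ => (Some T0, DR, true))))))).

Lemma runs_copy_cell l a x Z s r : nonblank l -> nonblank x -> blank Z ->
  exists2 Z', blank Z' &
  runs (copy_cell l) (Tape (nseq a (Some T0) ++ x ++ Z) s r) true
   (Tape (nseq a.+1 (Some T0) ++ (x ++ l) ++ Z') (head None r) (behead r))
   (2 * (a + size x + size l) + 6).
Proof.
move=> nl nx bZ; pose y := nseq a (Some T0) ++ x.
have ny : nonblank y by rewrite nonblank_cat nx andbT /nonblank all_nseq orbT.
have [Z' bZ' hw] := runs_writeL l (rev y ++ None :: r) (blank_behead bZ).
exists (None :: Z') => //.
have sy : size y = a + size x by rewrite size_cat size_nseq.
apply: (@runs_le _ _ _ _ (1 + ((size y).+1 + ((size l).+1 + (1 + ((size (rev l ++ rev y)).+1 + 1)))))).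
  by rewrite size_cat !size_rev sy; lia.
have -> : nseq a.+1 (Some T0) ++ (x ++ l) ++ None :: Z' =
   Some T0 :: (rev (rev l ++ rev y) ++ None :: Z').
  by rewrite rev_cat !revK /y /= -!catA.
rewrite catA -/y; apply: runs_seq; first exact: runs_act.
apply: runs_seq; first exact: runs_walkL (blank_head bZ).
apply: (runs_seq hw); apply: runs_seq; first exact: runs_act.
rewrite /= catA; apply: runs_seq.
  by apply: (runs_walkR (Z := None :: r)) => //; rewrite nonblank_cat !nonblank_rev nl.
exact: (@runs_act _ (Tape _ None r) (Some T0) DR).
Qed.

Definition is_sym a := act (fun x => (x, DS, x == Some a)).
(** Branching on the token keeps it in the control state while its cell is overwritten by the blank
    that marks the place. *)
Definition switch (f : tk -> mach) (e : mach) :=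
  ite (is_sym T0) (f T0) (ite (is_sym T1) (f T1)
    (ite (is_sym TNum) (f TNum) (ite (is_sym TSeq) (f TSeq) e))).

Lemma runs_switch f e t r t' n :
  runs (if tc t is Some a then f a else e) t r t' n -> runs (switch f e) t r t' (4 + n).
Proof.
have h a : runs (is_sym a) t (tc t == Some a) t 1.
  by rewrite -{3}(tape_stay t); apply: runs_act.
move=> ht; have := (h T0, h T1, h TNum, h TSeq); rewrite /switch; move: ht.
case: (tc t) => [[]|] ht [[[h0 h1] h2] h3].
- by apply: (runs_le _ (runs_ite h0 ht)); lia.
- by apply: (runs_le _ (runs_ite h0 (runs_ite h1 ht))); lia.
- by apply: (runs_le _ (runs_ite h0 (runs_ite h1 (runs_ite h2 ht)))); lia.
- by apply: (runs_le _ (runs_ite h0 (runs_ite h1 (runs_ite h2 (runs_ite h3 ht))))); lia.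
- by apply: (runs_le _ (runs_ite h0 (runs_ite h1 (runs_ite h2 (runs_ite h3 ht))))); lia.
Qed.

Section Preprocessing.
Variable W : nat.
Hypothesis W4 : 4 <= W.
Local Notation B := (W.*2).

(** Both bits are written as nonblank symbols because [walk] stops at a blank. The first block
    carries the marks of all heads but head [1], as these start at block [0]. *)
Definition blk (first : bool) (a : tk) : seq sym :=
  mkseq (fun r => Some (if (if odd r then r./2 == tk_code a else first && (r != head_cell 1))
                        then T1 else T0)) B.

Lemma nonblank_blk first a : nonblank (blk first a).
Proof. by rewrite /nonblank /blk all_map; apply/allP. Qed.

Definition blks (b : bool) (w : seq tk) : seq sym :=
  if w is a :: w' then blk b a ++ flatten (map (blk false) w') else [::].

Definition copy_all :=
  loop (switch (fun a => seqm (copy_cell (blk false a)) (ret true)) (ret false)).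

(** [a] counts the tokens already replaced by [T0]. Together with the tokens left it stays below the
    fixed [n], which gives one bound for the walks of all rounds. *)
Lemma runs_copy_all n w a x Z : size w + a <= n -> nonblank x -> blank Z ->
  size x = a * B ->
  exists2 Z', blank Z' &
  runs copy_all (Tape (nseq a (Some T0) ++ x ++ Z) (head None (map Some w)) (behead (map Some w)))
    false (Tape (nseq (a + size w) (Some T0) ++ (x ++ flatten (map (blk false) w)) ++ Z') None [::])
    (5 + size w * (2 * (n * B.+1) + 11)).
Proof.
elim: w a x Z => [|s w IHw] a x Z /= hn nx bZ sx.
  exists Z => //; rewrite cats0 addn0; apply: runs_loop_stop.
  by apply: runs_switch; apply: runs_ret.
have [Z1 bZ1 h1] := runs_copy_cell a (Some s) (map Some w) (nonblank_blk false s) nx bZ.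
have [|||Z2 bZ2 h2] := IHw a.+1 (x ++ blk false s) Z1 _ _ bZ1.
- by lia.
- by rewrite nonblank_cat nx nonblank_blk.
- by rewrite size_cat size_mkseq sx mulSn addnC.
exists Z2 => //; rewrite catA addnS -addSn.
have := runs_loop_next (runs_switch (t := Tape _ (Some s) _) (runs_seq h1 (runs_ret true _))) h2.
apply: runs_le; rewrite sx size_mkseq; nia.
Qed.

(** Walking left from the used input, the first blank met is cell [0] of the block following the
    copied input, and this is the block in which head [1] must receive its mark. *)
Definition preproc :=
  seqm (switch (fun a => copy_cell (blk true a)) (ret true)) (seqm copy_all
    (seqm (go DL) (seqm (walk DL) (seqm (goN DL (head_cell 1))
      (seqm (wr (Some T1)) (back B (head_cell 1))))))).

Definition init_state (w : seq tk) : state :=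
  State (fun h => if h == 1 then size w else 0)
        (fun k i => (i < size w) && (k == tk_code (nth T0 w i))).

Lemma size_blk b a : size (blk b a) = B. Proof. exact: size_mkseq. Qed.

Lemma size_blks b w : size (blks b w) = size w * B.
Proof.
case: w => //= a w; rewrite size_cat size_blk mulSn; congr (_ + _).
by elim: w => //= a' w IHw; rewrite size_cat size_blk IHw mulSn.
Qed.

Lemma nth_blks b w i r : r < B -> i < size w ->
  nth None (blks b w) (i * B + r) = nth None (blk (b && (i == 0)) (nth T0 w i)) r.
Proof.
have shift l l' j : size l = B -> nth None (l ++ l') (j.+1 * B + r) = nth (None : sym) l' (j * B + r).
  move=> sl; rewrite nth_cat sl mulSn -addnA ltnNge leq_addr /=; congr (nth _ _ _); lia.
move=> hr; case: w => //= a w; case: i => [_|i hi].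
  by rewrite mul0n add0n nth_cat size_blk hr andbT.
rewrite andbF shift ?size_blk //=; elim: w i hi => //= a' w IHw [|i] hi.
  by rewrite mul0n add0n nth_cat size_blk hr.
by rewrite shift ?size_blk //=; apply: IHw.
Qed.

Lemma repr_init w : 0 < size w ->
  repr_cells B (cell (init_state w)) (upd (nth None (blks true w)) (size w * B + head_cell 1) (Some T1)).
Proof.
move=> w0 i r hr; rewrite /upd; have -> :
  (i * B + r == size w * B + head_cell 1) = (i == size w) && (r == head_cell 1).
  apply/eqP/andP => [e|[/eqP -> /eqP ->] //].
  have h1 : head_cell 1 < B by rewrite /head_cell; lia.
  have : (i * B + r) %% B = (size w * B + head_cell 1) %% B by rewrite e.
  rewrite !modnMDl !modn_small // => er; split; last by apply/eqP.
  have : (i * B + r) %/ B = (size w * B + head_cell 1) %/ B by rewrite e.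
  have B0 : 0 < B by lia.
  by rewrite !divnMDl // !divn_small // !addn0 => ->.
case: (ltnP i (size w)) => hi.
  rewrite ltn_eqF //= nth_blks // nth_mkseq // /cell.
  case or: (odd r); rewrite /= ?hi; first by case: (r./2 == _).
  case: (r =P head_cell 1) => [->|ne] /=; first by rewrite andbF; apply/esym; rewrite gtn_eqF.
  case: (r./2 =P 1) => [e|_]; last by rewrite andbT [0 == i]eq_sym; case: (i == 0).
  by case: ne; rewrite -[r]odd_double_half or e.
rewrite nth_default; last by rewrite size_blks; nia.
rewrite /cell; case or: (odd r) => /=; first by rewrite ltnNge hi; case: (r =P head_cell 1) or => [-> //|_ _]; rewrite ?andbF.
case: (r =P head_cell 1) => [->|ne] /=; first by rewrite andbT [size w == i]eq_sym; case: (i == size w).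
rewrite andbF; case: (r./2 =P 1) => [e|_].
  by case: ne; rewrite -[r]odd_double_half or e.
by apply/esym; rewrite ltn_eqF //; lia.
Qed.

Lemma runs_preproc w : 0 < size w ->
  exists J T t, [/\ repr_cells B (cell (init_state w)) T, at_ J T 0 t &
    runs preproc (in_tape w) false t
      (100 * (B.+1 * (size w).+1 * (size w).+1))].
Proof.
move=> w0; have hT := repr_init w0.
have o0 : origin (cell (init_state w)) by move=> i; rewrite /cell /= eq_sym.
have h1 : head_cell 1 < B by rewrite /head_cell; lia.
case: w w0 hT o0 => // a w _ hT o0.
have [Z1 bZ1 r1] := @runs_copy_cell (blk true a) 0 [::] [::] (Some a) (map Some w)
   (nonblank_blk true a) isT isT.
have [||Z2 bZ2 r2] := @runs_copy_all (size w).+1 w 1 (blk true a) Z1 _ (nonblank_blk true a) bZ1.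
- by rewrite addn1.
- by rewrite size_blk mul1n.
pose y := blks true (a :: w).
have ny : nonblank y.
  rewrite /y [blks _ _]/=.
  rewrite nonblank_cat nonblank_blk andTb; elim: (w) => // a' w' IHw.
  by rewrite [flatten _]/= nonblank_cat nonblank_blk IHw.
move: r2; set q := nseq (1 + size w) _ => r2.
have ny' : nonblank (q ++ y).
  by rewrite nonblank_cat ny andbT /nonblank all_nseq orbT.
have szq : size q = (size w).+1 by rewrite size_nseq.
clearbody q.
have r3 := @runs_walkL _ Z2 [:: None] ny' (blank_head bZ2).
(* The used input cells and the blank behind them become the untouched part [J]. *)
set T0' := nth None (blks true (a :: w)); pose J := rev q ++ [:: None].
have at0 : at_ J T0' ((size w).+1 * B) (Tape (behead Z2) None (rev (q ++ y) ++ [:: None])).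
  split => /=.
  - rewrite rev_cat -catA -/J; congr (rev _ ++ _).
    by rewrite -[LHS](mkseq_nth None) /T0' size_blks.
  - by rewrite /T0' nth_default // size_blks.
  move=> i; rewrite /T0' [RHS]nth_default; last by rewrite size_blks /=; lia.
  have := blank_behead bZ2; elim: (behead Z2) i => [|z Z IHZ] [|i] //= /andP[/eqP hz bZ] //.
  exact: IHZ.
pose T1' := upd T0' ((size w).+1 * B + head_cell 1) (Some T1).
have r4 : runsA (seqm (goN DL (head_cell 1)) (seqm (wr (Some T1)) (back B (head_cell 1))))
  T0' ((size w).+1 * B) false T1' 0 ((head_cell 1).+1 + (1 + (size w).+3 * (B + 2))).
  apply: runsA_seq; first exact: runsA_goL.
  apply: runsA_seq; first exact: runsA_wr.
  exact: runsA_back hT o0 h1.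
have [t at1 r5] := r4 _ _ at0; exists J, T1', t; split => //.
have R1 := runs_switch (f := fun a => copy_cell (blk true a)) (e := ret true)
  (t := Tape [::] (Some a) (map Some w)) r1.
have R3 := @runs_act (fun x => (x, DL, true)) (Tape (q ++ y ++ Z2) None [::]) _ DL true erefl.
rewrite /= catA -{1}catA in R3.
have sq : size (q ++ y) = (size w).+1 + (size w).+1 * B.
  by rewrite size_cat szq size_blks.
apply: runs_le (runs_seq R1 (runs_seq r2 (runs_seq R3 (runs_seq r3 r5)))).
rewrite sq size_blk /= /head_cell; nia.
Qed.

Lemma runs_cmd p A w : wf W p -> A < W -> 0 < size w ->
  exists2 t, runs (seqm preproc (seqm (compile B p) (goN DL (track_cell A)))) (in_tape w) true t
      (100 * (B.+1 * (size w).+1 * (size w).+1) +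
       (unit_cost B (size w + ops p (size w)) * ops p (size w) + (track_cell A).+1)) &
    (tc t == Some T1) = trk (sem p (init_state w)) A 0.
Proof.
move=> wp hA w0; have [J [T [t [hT ht r1]]]] := runs_preproc w0.
have [||r R] := @runs_comp W p (init_state w) (size w) _ _ wp erefl _ (leqnn _).
- by lia.
- by move=> h /=; case: ifP.
have [T' hT' /(_ _ _ ht) [t' ht' r2]] := R _ hT.
have [t'' [_ e _] r3] := @runsA_goL (track_cell A) T' 0 _ _ ht'.
exists t''; first exact: runs_seq r1 (runs_seq r2 r3).
by rewrite e -(mul0n B) hT' ?cell_tr // /track_cell; lia.
Qed.

End Preprocessing.

(** The width is at least 4 since tracks [0] to [3] carry the four kinds of tokens. The answer is
    read by moving from cell [0] to the cell of track [A] in the same block. *)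
Theorem poly_time_cmd W p A : 4 <= W -> wf W p -> A < W ->
  exists (M : TM) (c d : nat), forall w, 0 < size w ->
    tm_answers_within M w (c * (size w).+1 ^ d) (trk (sem p (init_state w)) A 0).
Proof.
move=> W4 wp hA; pose cost n := (100 * (W.*2.+1 * n.+1 * n.+1) +
  (unit_cost W.*2 (n + ops p n) * ops p n + (track_cell A).+1)).+1.
have [c [d hc]] : polyb cost.
  have pc := polyb_const; have pS := polyb_S polyb_id; have po := polyb_ops p.
  apply: polyb_S; apply: polyb_add.
    by do !apply: polyb_mul.
  apply: polyb_add => //; apply: polyb_mul => //; rewrite /unit_cost.
  apply: polyb_mul => //; apply: polyb_mul => //; do 2!apply: polyb_S.
  by apply: polyb_add => //; apply: polyb_id.
exists (tmM (seqm (preproc W) (seqm (compile W.*2 p) (goN DL (track_cell A))))), c, d => w w0.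
have [t ht <-] := runs_cmd W4 wp hA w0.
by apply: tmM_answers ht; apply: leq_trans (hc _).
Qed.

(** * Symbolic execution *)

(* [ptr j] moves through sequence [j], whose first token is at [seg j].  When the loops
   are at the tuple of pointers number [m], heads [CUR] and [next_cell j] are at [m] and
   [m + (N+1)^j], the latter being the number of the tuple with pointer [j] advanced. *)
Notation END := 1 (only parsing).
Notation X := 2 (only parsing).
Notation Y := 3 (only parsing).
Notation Z := 4 (only parsing).
Notation U := 5 (only parsing).
Notation V := 6 (only parsing).
Notation CNT := 7 (only parsing).
Notation PLACES := 8 (only parsing).
Notation POW := 9 (only parsing).
Notation TMP := 10 (only parsing).
Notation CUR := 11 (only parsing).
Definition ptr j := 3 * j + 12.
Definition seg j := 3 * j + 13.
Definition next_cell j := 3 * j + 14.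

(* Tracks 0 to 3 hold the input, one for each token.  [MARK] holds the first [TNum] of
   every bin, [REM] the positions already passed by the pointer of their sequence, [TBL]
   the reachable tuples.  The other tracks are flags: only their bit at block 0 is used. *)
Notation MARK := 4 (only parsing).
Notation REM := 5 (only parsing).
Notation TBL := 6 (only parsing).
Notation ANS := 7 (only parsing).
Notation ACT := 8 (only parsing).
Notation EQ := 9 (only parsing).
Notation FAIL := 10 (only parsing).
Notation OPN := 11 (only parsing).
Notation BEF := 12 (only parsing).
Notation BAD := 13 (only parsing).
Notation PAR := 14 (only parsing).
Notation RM := 15 (only parsing).

Notation IfT h k := (If h (track_cell k)) (only parsing).
Notation IfH h h' := (If h (head_cell h')) (only parsing).
Notation IfB k := (If 0 (track_cell k)) (only parsing).
Notation SetB := (Put 0) (only parsing).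

(** The invariant ends at [(pos st 1).+1] because a loop also visits the block of head [1]. *)
Lemma for_ind (I : nat -> state -> Prop) h b st : I 0 st ->
  (forall i s, i <= pos st 1 -> I i s -> I i.+1 (sem b (setp s h i))) ->
  I (pos st 1).+1 (sem (For h b) st).
Proof.
move=> I0 IS /=; rewrite uptoE.
suff H m : m <= (pos st 1).+1 ->
  I m (foldl (fun s i => sem b (setp s h i)) st (iota 0 m)) by exact: H.
elim: m => // m IHm le_m; rewrite -addn1 iotaD foldl_cat /= add0n addn1.
by apply: IS => //; apply: IHm; apply: ltnW.
Qed.

Definition setk st k i v := State (pos st) (updC (trk st) k i v).

Lemma sem_Skip st : sem Skip st = st. Proof. by []. Qed.
Lemma sem_Sq a b st : sem (a ;; b) st = sem b (sem a st). Proof. by []. Qed.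
Lemma sem_Put h k v st : sem (Put h k v) st = setk st k (pos st h) v. Proof. by []. Qed.
Lemma sem_Right h st : sem (Right h) st = setp st h (pos st h).+1. Proof. by []. Qed.
Lemma sem_Copy h h' st : sem (Copy h h') st = setp st h (pos st h'). Proof. by []. Qed.

Lemma sem_IfT h k a b st :
  sem (IfT h k a b) st = if trk st k (pos st h) then sem a st else sem b st.
Proof. by rewrite /= cell_tr. Qed.

Lemma sem_IfH h h' a b st :
  sem (IfH h h' a b) st = if pos st h' == pos st h then sem a st else sem b st.
Proof. by rewrite /= cell_hd. Qed.

(* Matches syntactically, so that named subprograms stay folded. *)
Ltac exec := repeat match goal with
  | |- context [sem Skip ?s] => rewrite (sem_Skip s)
  | |- context [sem (Sq ?a ?b) ?s] => rewrite (sem_Sq a b s)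
  | |- context [sem (Put ?h ?k ?v) ?s] => rewrite (sem_Put h k v s)
  | |- context [sem (Right ?h) ?s] => rewrite (sem_Right h s)
  | |- context [sem (Copy ?h ?h') ?s] => rewrite (sem_Copy h h' s)
  | |- context [sem (If ?h (track_cell ?k) ?a ?b) ?s] => rewrite (sem_IfT h k a b s)
  | |- context [sem (If ?h (head_cell ?h') ?a ?b) ?s] => rewrite (sem_IfH h h' a b s)
  end.

Lemma pos_setp s h i h' : pos (setp s h i) h' = if h' == h then i else pos s h'.
Proof. by []. Qed.
Lemma trk_setp s h i : trk (setp s h i) = trk s. Proof. by []. Qed.
Lemma pos_setk s k i v : pos (setk s k i v) = pos s. Proof. by []. Qed.
Lemma trk_setk s k i v k' i' :
  trk (setk s k i v) k' i' = if (k' == k) && (i' == i) then v else trk s k' i'.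
Proof. by []. Qed.

Definition obsE := (pos_setp, trk_setp, pos_setk, trk_setk).

Arguments sem : simpl never.
Arguments setp : simpl never.
Arguments setk : simpl never.

(** Copying the addend first permits [a = b], that is, doubling. A loop cannot be left early; the
    flag [ACT] makes its remaining rounds idle instead. *)
Definition AddCap a b :=
  Copy TMP b ;; SetB ACT true ;;
  For Z (IfB ACT (IfH Z TMP (SetB ACT false) (IfH a END Skip (Right a))) Skip).

Lemma AddCapP a b st : pos st 0 = 0 -> a \notin [:: 0; 1; 4; 10] ->
  pos st a <= pos st 1 -> pos st b <= pos st 1 ->
  pos (sem (AddCap a b) st) a = minn (pos st 1) (pos st a + pos st b).
Proof.
move=> p0 a1; rewrite /AddCap; exec; set s0 := setk _ _ _ _.
have na h : h \in [:: 0; 1; 4; 10] -> ((h == a) = false) * ((a == h) = false).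
  by move=> hl; split; apply: contraNF a1 => /eqP; [move <- | move ->].
have e0 : pos s0 a = pos st a by rewrite !obsE na.
have e1 : pos s0 1 = pos st 1 by rewrite !obsE.
rewrite -e1 -e0; move eN: (pos s0 1) => N hx; move ey: (pos st b) => y hy.
move: hx; move ex: (pos s0 a) => x hx.
pose I i s := [/\ pos s 0 = 0, pos s 1 = N, pos s 10 = y,
  trk s 8 0 = (i <= y) & pos s a = minn N (x + minn i y)].
suff [_ _ _ _ ->] : I (pos s0 1).+1 (sem (For 4 (IfB 8 (IfH 4 10 (SetB 8 false) (IfH a 1 Skip (Right a))) Skip)) s0).
  by rewrite eN; congr minn; lia.
apply: for_ind => [|i s].
  by split; rewrite ?ex //; first [rewrite !obsE /= p0 // | lia].
rewrite eN => hi [h0 h1 h10 h8 ha]; exec; rewrite !obsE /= !na // h0 h1 h10 h8 ha.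
have o := (eqxx, obsE, na, h0, h1, h10, h8, ha).
case: (leqP i y) => hiy; last by split; rewrite ?o /= ?o //; lia.
case: eqP => [ei|ne]; first by split; rewrite ?o /= ?o //; lia.
by case: eqP => ?; split; rewrite ?o /= ?o //; lia.
Qed.

(** * The number of places *)

Definition holds_input (w : seq tk) s := [/\ pos s 0 = 0, pos s 1 = size w &
  forall k i, k < 4 -> trk s k i = (i < size w) && (k == tk_code (nth T0 w i))].

Lemma holds_input_init w : holds_input w (init_state w).
Proof. by split. Qed.

Lemma holds_input_setp w s h i : holds_input w s -> 1 < h -> holds_input w (setp s h i).
Proof.
case=> h0 h1 hk h1h; split=> //; rewrite !obsE.
  by case: eqP => // e; rewrite -e in h1h.
by case: eqP => // e; rewrite -e in h1h.
Qed.

Lemma holds_input_setk w s k i v : holds_input w s -> 3 < k -> holds_input w (setk s k i v).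
Proof.
case=> h0 h1 hk h1h; split=> // k' j k4.
by rewrite !obsE hk //; case: eqP => //; lia.
Qed.

Lemma holds_input_sem w s p : holds_input w s -> all (leq 2) (mod_heads p) -> all (leq 4) (mod_tracks p) -> holds_input w (sem p s).
Proof.
case=> h0 h1 hk /allP hp /allP tp; split.
- by rewrite sem_mod_heads //; apply/negP => /hp.
- by rewrite sem_mod_heads //; apply/negP => /hp.
by move=> k i k4; rewrite sem_mod_tracks ?hk //; apply/negP => /tp; rewrite leqNgt k4.
Qed.

(** Turns a loop over the blocks into a left fold over the tokens. The round on the block after the
    input sees no token, so the last premise asks that it be neutral. *)
Lemma scan_ind A (R : A -> state -> Prop) f a0 w h b st :
  all (leq 2) (h :: mod_heads b) -> all (leq 4) (mod_tracks b) -> holds_input w st -> R a0 st ->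
  (forall i s, i < size w -> holds_input w s -> R (foldl f a0 (take i w)) s ->
     R (f (foldl f a0 (take i w)) (nth T0 w i)) (sem b (setp s h i))) ->
  (forall a s, holds_input w s -> R a s -> R a (sem b (setp s h (size w)))) ->
  R (foldl f a0 w) (sem (For h b) st).
Proof.
move=> /= /andP[h1 hb] tb ist R0 RS RE; have [_ e1 _] := ist.
pose I i s := holds_input w s /\ R (foldl f a0 (take i w)) s.
suff [_] : I (pos st 1).+1 (sem (For h b) st) by rewrite take_oversize // e1.
apply: for_ind => [|i s]; first by rewrite /I take0.
rewrite e1 => hi [si Rs]; split; first by apply: holds_input_sem => //; apply: holds_input_setp.
case: (ltnP i (size w)) => hiw; last first.
  have -> : i = size w by lia.
  rewrite take_oversize // in Rs *; rewrite take_oversize //; exact: RE.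
by rewrite (take_nth T0) // -cats1 foldl_cat; apply: RS.
Qed.

(* The reset at [TSeq] discards all numbers but the last one; the cap at the input length
   is harmless because it bounds the number of open pallets. *)
Definition PlacesStep := IfT X 3 (Copy PLACES 0 ;; Copy POW 0 ;; Right POW)
  (IfT X 0 (AddCap POW POW)
    (IfT X 1 (AddCap PLACES POW ;; AddCap POW POW) Skip)).
Definition Places := Copy PLACES 0 ;; Copy POW 0 ;; For X PlacesStep.

Definition pstep N (vq : nat * nat) (a : tk) : nat * nat :=
  match a with
  | T0 => (vq.1, minn N (vq.2 + vq.2))
  | T1 => (minn N (vq.1 + vq.2), minn N (vq.2 + vq.2))
  | TNum => vq
  | TSeq => (0, 1)
  end.

Lemma AddCap_holds_input a b w s : holds_input w s -> a \in [:: 8; 9] -> b \in [:: 8; 9] ->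
  pos s 8 <= size w -> pos s 9 <= size w ->
  pos (sem (AddCap a b) s) a = minn (size w) (pos s a + pos s b).
Proof.
case=> h0 h1 _; rewrite !inE => ha hb h8 h9.
have hN x : (x == 8) || (x == 9) -> pos s x <= pos s 1 by rewrite h1 => /orP[] /eqP ->.
by rewrite AddCapP ?hN ?h1 //; case/orP: ha => /eqP ->.
Qed.

Lemma PlacesP w st : holds_input w st -> 0 < size w ->
  pos (sem Places st) PLACES = (foldl (pstep (size w)) (0, 0) w).1.
Proof.
move=> ist w0; set N := size w.
pose R (vq : nat * nat) s := [/\ pos s 8 = vq.1, pos s 9 = vq.2, vq.1 <= N & vq.2 <= N].
rewrite /Places; exec; set st1 := setp _ 9 _.
have i1 : holds_input w st1 by apply: holds_input_setp => //; apply: holds_input_setp.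
suff [] : R (foldl (pstep N) (0, 0) w) (sem (For 2 PlacesStep) st1) by [].
apply: scan_ind => // [|i s hi is0 Rs|vq s is0 Rs].
- by case: (ist) => p0 _ _; split; rewrite // !obsE /= ?p0.
- have is1 : holds_input w (setp s 2 i) by apply: holds_input_setp.
  move: (foldl _ _ _) Rs => [v q] [/= ev eq lev leq]; case: (is1) => [h0 h1 hk].
  rewrite /PlacesStep; exec; rewrite !hk // !obsE eqxx hi !andTb.
  case: (nth T0 w i); rewrite [_ == _]/=; cbv iota.
  + split => /=; rewrite ?geq_minl //; first by rewrite sem_mod_heads.
    by rewrite (AddCap_holds_input is1) // !obsE /= ?ev ?eq.
  + have is2 : holds_input w (sem (AddCap 8 9) (setp s 2 i)) by apply: holds_input_sem.
    have e9 : pos (sem (AddCap 8 9) (setp s 2 i)) 9 = q by rewrite sem_mod_heads.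
    have e8 : pos (sem (AddCap 8 9) (setp s 2 i)) 8 = minn N (v + q).
      by rewrite (AddCap_holds_input is1) // !obsE /= ?ev ?eq.
    split => /=; rewrite ?geq_minl //; last by rewrite (AddCap_holds_input is2) ?e8 ?e9 // geq_minl.
    by rewrite sem_mod_heads.
  + by split.
  by have [p00 _ _] := is0; split; rewrite // ?(pos_setp, trk_setp) /= ?p00.
case: vq Rs => v q [/= ev eq lev leq].
case: (holds_input_setp N is0 (isT : 1 < 2)) => [h0 h1 hk].
by rewrite /PlacesStep; exec; rewrite !hk // !obsE eqxx ltnn.
Qed.

(** [bits] lists the least significant digit first, so [q] runs through the powers of two.
    Truncating at [N] commutes with addition, hence truncating at every step amounts to truncating
    once at the end. *)
Lemma foldl_pstep_bits N f n v q : n <= f ->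
  (foldl (pstep N) (minn N v, minn N q) (bits_aux f n)).1 = minn N (v + q * n).
Proof.
elim: f n v q => [|f IHf] n v q hn /=; first by rewrite (_ : n = 0) ?muln0 ?addn0 //; lia.
case: eqP => [->|n0]; first by rewrite muln0 addn0.
have en := odd_double_half n; rewrite -/bits_aux.
have -> : foldl (pstep N) (minn N v, minn N q) ((if odd n then T1 else T0) :: bits_aux f n./2)
   = foldl (pstep N) (minn N (v + odd n * q), minn N (q + q)) (bits_aux f n./2).
  rewrite [LHS]/=; congr foldl; case: (odd n); rewrite /pstep /=; congr pair; lia.
by rewrite IHf; [congr minn; nia | lia].
Qed.

(** With at least one sequence, a [TSeq] stands immediately before the encoding of [p] and resets
    the fold to [(0, 1)]. *)
Lemma foldl_pstep_input N Q p : 0 < N -> 0 < size Q ->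
  (foldl (pstep N) (0, 0) (enc_input Q p)).1 = minn N p.
Proof.
move=> N0; case/lastP: Q => // Q q _.
rewrite /enc_input map_rcons flatten_rcons /enc_seq -!catA !foldl_cat /=.
have -> : (0, 1) = (minn N 0, minn N 1) by congr (_, _); lia.
by rewrite foldl_pstep_bits // mul1n.
Qed.

(** * Positions of sequences and bins *)

(** The closing [TSeq] is stepped over as well, so that [a] ends on the first token of the next
    sequence. *)
Definition NextSeq a b := Copy a b ;; SetB ACT true ;;
  For Z (IfB ACT (IfT a 3 (SetB ACT false ;; Right a) (Right a)) Skip).

Lemma NextSeqP w st a b body rest : holds_input w st -> a \notin [:: 0; 1; 4] ->
  drop (pos st b) w = body ++ TSeq :: rest -> TSeq \notin body ->
  pos (sem (NextSeq a b) st) a = pos st b + (size body).+1.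
Proof.
move=> ist na ew nb; have a1 : 1 < a by move: na; rewrite !inE; lia.
have na4 : (4 == a) = false by apply: contraNF na => /eqP <-.
have {}na : (a == 4) = false by rewrite eq_sym.
have hsz : pos st b + (size body).+1 <= size w.
  have /(congr1 size) := ew; rewrite size_drop size_cat /=; lia.
have hnth i : nth T0 w (pos st b + i) = nth T0 (body ++ TSeq :: rest) i.
  by rewrite -ew nth_drop.
rewrite /NextSeq; exec; move: hsz hnth; move: (pos st b) => x hsz hnth.
set s0 := setk _ _ _ _; have [p0 _ _] := ist.
pose I i s := [/\ holds_input w s, trk s 8 0 = (i <= size body) & pos s a = x + minn i (size body).+1].
have a0 : (0 == a) = false by apply/eqP; lia.
have is0 : holds_input w s0 by apply: holds_input_setk => //; apply: holds_input_setp.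
have [_ e1 _] := is0; set F := For _ _.
suff [_ _ ->] : I (pos s0 1).+1 (sem F s0) by rewrite e1; lia.
apply: for_ind => [|i s].
  by split; rewrite // !obsE ?a0 ?p0 ?eqxx /= ?addn0.
rewrite e1 => hi [is1 h8 ha]; have [h0 h1 hk] := is1.
have is2 : holds_input w (setp s 4 i) by apply: holds_input_setp.
have is3 j : holds_input w (setp (setp s 4 i) a j) by apply: holds_input_setp.
have is4 j : holds_input w (setp (setk (setp s 4 i) 8 0 false) a j).
  by apply: holds_input_setp => //; apply: holds_input_setk.
exec; rewrite !obsE [0 == 4]/= h0 h8 na ha hk // hnth.
case: (leqP i (size body)) => hib; last by split; rewrite // !obsE ?na ?h8 ?ha; lia.
rewrite (_ : x + minn i (size body).+1 < size w); last lia.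
rewrite andTb (_ : minn i (size body).+1 = i); last lia.
rewrite nth_cat; case: ltnP => hlt.
  have -> : (3 == tk_code (nth T0 body i)) = false.
    apply: contraNF nb; case e: (nth T0 body i) => //= _; rewrite -e; exact: mem_nth.
  by split; rewrite // !obsE ?h8 ?ha ?eqxx ?na; lia.
have -> : i - size body = 0 by lia.
rewrite eqxx; split; rewrite // !obsE ?h0 ?eqxx /= ?ha ?eqxx; lia.
Qed.

Fixpoint Starts j := if j is j'.+1 then Starts j' ;; NextSeq (seg j) (seg j') else Copy (seg 0) 0.

Definition start (Q : seq (seq bin)) i := size (flatten (map enc_seq (take i Q))).


Lemma mod_heads_Starts j x : x \in mod_heads (Starts j) -> x = 4 \/ exists2 i, i <= j & x = seg i.
Proof.
elim: j => [|j IHj] /=; first by rewrite inE => /eqP ->; right; exists 0.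
rewrite mem_cat => /orP[/IHj [->|[i hi ->]]|]; [by left | by right; exists i => //; lia |].
by rewrite !inE => /or4P[] /eqP ->; [right|left|right|right] => //; exists j.+1.
Qed.

Lemma mod_tracks_Starts j x : x \in mod_tracks (Starts j) -> x = 8.
Proof.
by elim: j => [|j IHj] //=; rewrite mem_cat !inE => /orP[/IHj //|/orP[] /eqP].
Qed.

Lemma no_sym_bits f n a : a \notin [:: T0; T1] -> a \notin bits_aux f n.
Proof.
rewrite !inE negb_or => /andP[a0 a1]; elim: f n => //= f IHf n.
by case: eqP => // _; rewrite inE negb_or IHf andbT; case: odd.
Qed.

Lemma no_TSeq_bins q : TSeq \notin flatten (map enc_bin q).
Proof.
elim: q => //= b q IHq; rewrite mem_cat negb_or IHq andbT /enc_bin /enc_num.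
by rewrite !mem_cat !inE /bits !negb_or !no_sym_bits.
Qed.

Lemma start0 Q : start Q 0 = 0. Proof. by rewrite /start take0. Qed.

Lemma startS Q i : i < size Q -> start Q i.+1 = start Q i + size (enc_seq (nth [::] Q i)).
Proof.
move=> hi; rewrite /start (take_nth [::]) // map_rcons flatten_rcons size_cat //.
Qed.

Lemma drop_start Q p i : i < size Q ->
  exists rest, drop (start Q i) (enc_input Q p) = enc_seq (nth [::] Q i) ++ rest.
Proof.
move=> hi; rewrite /enc_input -{2}(cat_take_drop i Q) map_cat flatten_cat -catA.
rewrite drop_size_cat // (drop_nth [::]) //= -catA; by eexists.
Qed.

Lemma StartsP Q p st j : holds_input (enc_input Q p) st -> j < size Q ->
  forall i, i <= j -> pos (sem (Starts j) st) (seg i) = start Q i.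
Proof.
move=> ist; elim: j => [|j IHj] hj i /= hi.
  by rewrite (_ : i = 0) ?start0; [rewrite /upd eqxx; case: ist | lia].
have is1 : holds_input (enc_input Q p) (sem (Starts j) st).
  apply: holds_input_sem => //; apply/allP => x.
    by case/mod_heads_Starts => [->|[l _ ->]] //; rewrite /seg; lia.
  by move/mod_tracks_Starts ->.
exec; case: (ltnP i j.+1) => hij.
  rewrite sem_mod_heads ?IHj //; first lia.
  by rewrite /= !inE /seg; lia.
have -> : i = j.+1 by lia.
have [rest e] := drop_start p (ltnW hj); rewrite /enc_seq -catA in e.
have ej := IHj (ltnW hj) j (leqnn j).
rewrite (NextSeqP (body := flatten (map enc_bin (nth [::] Q j))) (rest := rest) is1).
- by rewrite ej startS ?size_cat ?addn1 //; lia.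
- by rewrite !inE /seg; lia.
- by rewrite ej e.
exact: no_TSeq_bins.
Qed.

(** The position is that of the [TNum] closing the identifier: the token after it begins the pallet
    symbol, so a mark gives access to the pallet without a further search. *)
Fixpoint marks_seq o (q : seq bin) : seq (nat * bin) :=
  if q is b :: q' then (o + size (bits b.1), b) :: marks_seq (o + size (enc_bin b)) q'
  else [::].

Fixpoint marks o (Q : seq (seq bin)) : seq (nat * bin) :=
  if Q is q :: Q' then marks_seq o q ++ marks (o + size (enc_seq q)) Q' else [::].

(* A position is marked on reaching the second [TNum] of its bin, hence not for the [TNum]
   that ends the number of places. *)
Definition MarksStep := IfT X 2
  (IfB PAR (SetB PAR false ;; Put U MARK true) (SetB PAR true ;; Copy U X)) Skip.
Definition Marks := For X MarksStep.

(** Mirror of [MarksStep] on tokens: current position, parity of the [TNum] seen, pending candidate,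
    marks so far. *)
Definition mstep (m : nat * bool * nat * seq nat) (a : tk) :=
  let: (i, par, u, ms) := m in
  if a is TNum then if par then (i.+1, false, u, rcons ms u) else (i.+1, true, i, ms)
  else (i.+1, par, u, ms).

Lemma foldl_mstep_bits i par u ms f n :
  foldl mstep (i, par, u, ms) (bits_aux f n) = (i + size (bits_aux f n), par, u, ms).
Proof.
elim: f i n => [|f IHf] i n /=; first by rewrite addn0.
by case: eqP => _ /=; rewrite ?addn0 //; case: odd; rewrite IHf addSnnS.
Qed.

Lemma foldl_mstep_bin i u ms b (x := i + size (bits b.1)) :
  foldl mstep (i, false, u, ms) (enc_bin b) = (i + size (enc_bin b), false, x, rcons ms x).
Proof.
rewrite /enc_bin /enc_num !foldl_cat /= /bits foldl_mstep_bits /= foldl_mstep_bits /=.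
by congr (_, _, _, _); rewrite !size_cat /= /bits; lia.
Qed.

Lemma enc_seq_cons b q : enc_seq (b :: q) = enc_bin b ++ enc_seq q.
Proof. by rewrite /enc_seq /= catA. Qed.

Lemma foldl_mstep_seq i u ms q : exists u',
  foldl mstep (i, false, u, ms) (enc_seq q) =
  (i + size (enc_seq q), false, u', ms ++ map fst (marks_seq i q)).
Proof.
elim: q i u ms => [|b q IHq] i u ms; first by exists u; rewrite /= cats0 addn1.
rewrite enc_seq_cons foldl_cat foldl_mstep_bin.
have [u' ->] := IHq (i + size (enc_bin b)) (i + size (bits b.1)) (rcons ms (i + size (bits b.1))).
by exists u'; rewrite /= cat_rcons size_cat addnA.
Qed.

Lemma foldl_mstep_seqs i u ms Q : exists u',
  foldl mstep (i, false, u, ms) (flatten (map enc_seq Q)) =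
  (i + size (flatten (map enc_seq Q)), false, u', ms ++ map fst (marks i Q)).
Proof.
elim: Q i u ms => [|q Q IHQ] i u ms /=; first by exists u; rewrite cats0 addn0.
rewrite foldl_cat; have [u1 ->] := foldl_mstep_seq i u ms q.
have [u2 ->] := IHQ (i + size (enc_seq q)) u1 (ms ++ map fst (marks_seq i q)).
by exists u2; rewrite size_cat map_cat catA addnA.
Qed.

Lemma MarksP Q p st : holds_input (enc_input Q p) st ->
  (forall x, trk st MARK x = false) -> trk st PAR 0 = false ->
  forall x, trk (sem Marks st) MARK x = (x \in map fst (marks 0 Q)).
Proof.
set w := enc_input Q p => ist hm0 hp0.
pose R (m : nat * bool * nat * seq nat) s := let: (i, par, u, ms) := m in
  [/\ trk s 14 0 = par, pos s 5 = u & forall x, trk s 4 x = (x \in ms)].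
have idx i : i <= size w -> (foldl mstep (0, false, pos st 5, [::]) (take i w)).1.1.1 = i.
  elim: i => [|i IHi] hi; first by rewrite take0.
  rewrite (take_nth T0) // -cats1 foldl_cat /=; move: (IHi (ltnW hi)).
  by case: (foldl _ _ _) => [[[? [] ?] ?]] /= ->; case: (nth T0 w i).
suff : R (foldl mstep (0, false, pos st 5, [::]) w) (sem (For 2 MarksStep) st).
  rewrite {1}/w /enc_input foldl_cat; have [u ->] := foldl_mstep_seqs 0 (pos st 5) [::] Q.
  by rewrite /enc_num foldl_cat foldl_mstep_bits /= => -[].
apply: scan_ind => // [i s hi is0|m s is0].
  have := idx i (ltnW hi); case: (foldl _ _ _) => [[[i' par] u] ms] /= -> {i'} [hpar hu hms].
  have [h0 h1 hk] := holds_input_setp i is0 (isT : 1 < 2).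
  rewrite /MarksStep; exec; rewrite hk // !obsE [0 == 2]/= eqxx hi andTb.
  have p0 : pos s 0 = 0 by case: is0.
  rewrite p0 hpar; case: (nth T0 w i); rewrite [2 == tk_code _]/=; cbv iota; try by split.
  case: par hpar => hpar; split=> [||x]; rewrite ?obsE /= ?p0 //.
  by rewrite hu mem_rcons inE hms; case: eqP.
case: m => [[[i par] u] ms] [hpar hu hms].
have [h0 h1 hk] := holds_input_setp (size w) is0 (isT : 1 < 2).
by rewrite /MarksStep; exec; rewrite hk // !obsE eqxx ltnn.
Qed.

(** * Comparing pallets, marking removed bins *)

Definition SameStep :=
  let adv := Right U ;; Right V in
  let fail := SetB EQ false ;; SetB ACT false in
  IfT U 0 (IfT V 0 adv fail) (IfT U 1 (IfT V 1 adv fail) (IfT V 2 (SetB ACT false) fail)).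
Definition SameLoop := For Z (IfB ACT SameStep Skip).
Definition Same := Copy U X ;; Copy V Y ;; Right U ;; Right V ;;
  SetB EQ true ;; SetB ACT true ;; SameLoop.

Definition is_bits (b : seq tk) := all [pred a | (a == T0) || (a == T1)] b.

Lemma is_bits_nth b i : is_bits b -> i < size b -> nth T0 b i = T0 \/ nth T0 b i = T1.
Proof. by move=> /(all_nthP T0) h /h /orP[] /eqP ->; [left | right]. Qed.

(** The closing [TNum] serves as an end marker: a difference in length shows up as a bit facing a
    [TNum]. As long as [ACT] is set, the first [i] bits are known to agree. *)
Lemma SameP w st b1 b2 r1 r2 : holds_input w st -> is_bits b1 -> is_bits b2 ->
  drop (pos st X).+1 w = b1 ++ TNum :: r1 -> drop (pos st Y).+1 w = b2 ++ TNum :: r2 ->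
  trk (sem Same st) EQ 0 = (b1 == b2).
Proof.
move=> ist bb1 bb2 e1 e2; have [p0 pN _] := ist.
set x := pos st 2 in e1; set y := pos st 3 in e2.
have d1 i : nth T0 w (x.+1 + i) = nth T0 (b1 ++ TNum :: r1) i by rewrite -e1 nth_drop.
have d2 i : nth T0 w (y.+1 + i) = nth T0 (b2 ++ TNum :: r2) i by rewrite -e2 nth_drop.
have s1 : x.+1 + size b1 < size w by have := congr1 size e1; rewrite size_drop size_cat /=; lia.
have s2 : y.+1 + size b2 < size w by have := congr1 size e2; rewrite size_drop size_cat /=; lia.
rewrite /Same; exec; set s0 := setk _ _ _ _.
have is0 : holds_input w s0 by do 2!apply: holds_input_setk => //; do 4!apply: holds_input_setp => //.
have [_ eN _] := is0.
pose I i s := holds_input w s /\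
  if trk s 8 0 then [/\ trk s 9 0, (i <= size b1) && (i <= size b2), take i b1 = take i b2,
     pos s 5 = x.+1 + i & pos s 6 = y.+1 + i]
  else trk s 9 0 = (b1 == b2).
suff [_] : I (pos s0 1).+1 (sem SameLoop s0).
  (* [ACT] cannot survive all rounds, as their number exceeds the length of [b1]. *)
  by rewrite eN; case: (trk _ 8 0) => // -[_ h]; lia.
apply: for_ind => [|i s].
  split; rewrite // !obsE /= p0; split; rewrite ?take0 //.
  - by rewrite addn0.
  by rewrite addn0.
rewrite eN => hi [is1]; have is2 : holds_input w (setp s 4 i) by apply: holds_input_setp.
have [q0 _ _] := is1.
exec; rewrite !obsE [0 == 4]/= q0; case h8 : (trk s 8 0); last by split; rewrite // !obsE h8.
move=> [h9 /andP[l1 l2] et u v]; have [h0 h1 hk] := is2.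
split; first by apply: holds_input_sem.
rewrite /SameStep; exec; rewrite !hk // !obsE /= u v q0.
rewrite (_ : x.+1 + i < size w); last lia.
rewrite (_ : y.+1 + i < size w); last lia.
rewrite !andTb !d1 !d2 !nth_cat.
have hneq (b b' : seq tk) : size b <> size b' -> (b == b') = false.
  by move=> ne; apply/eqP => e; case: ne; rewrite e.
have failE s' : trk (setk (setk s' 9 0 false) 8 0 false) 8 0 = false /\
   trk (setk (setk s' 9 0 false) 8 0 false) 9 0 = false by rewrite !obsE.
case: (ltnP i (size b1)) => i1; case: (ltnP i (size b2)) => i2; last first.
- have [-> ->] : i - size b1 = 0 /\ i - size b2 = 0 by lia.
  rewrite !obsE /= h9; apply/esym/eqP.
  by move: et; rewrite !take_oversize.
- have ne : (b1 == b2) = false by apply: hneq; lia.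
  rewrite (_ : i - size b1 = 0) /=; last lia.
  by have [] := is_bits_nth bb2 i2 => ->; rewrite /= ?obsE /= ne.
- have ne : (b1 == b2) = false by apply: hneq; lia.
  rewrite (_ : i - size b2 = 0) /=; last lia.
  by have [] := is_bits_nth bb1 i1 => ->; rewrite /= ?obsE /= ne.
have hne : nth T0 b1 i <> nth T0 b2 i -> (b1 == b2) = false.
  by move=> ne; apply/eqP => e; case: ne; rewrite e.
have etS : nth T0 b1 i = nth T0 b2 i -> take i.+1 b1 = take i.+1 b2.
  by move=> e; rewrite !(take_nth T0) // et e.
move: hne etS.
by have [] := is_bits_nth bb2 i2 => ->; have [] := is_bits_nth bb1 i1 => -> hne etS;
  rewrite /= ?obsE /= ?h8 ?hne //; split; rewrite ?etS ?i1 ?i2 // ?addnS.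
Qed.

Fixpoint SetFlags (c : nat -> nat) (v : bool) (k : nat) :=
  if k is j.+1 then SetFlags c v j ;; IfH X (c j) (SetB RM v) Skip else Skip.

Lemma mod_heads_SetFlags c v k : mod_heads (SetFlags c v k) = [::].
Proof. by elim: k => //= k ->. Qed.

Lemma mod_tracks_SetFlags c v k x : x \in mod_tracks (SetFlags c v k) -> x = 15.
Proof. by elim: k => //= k IHk; rewrite mem_cat inE => /orP[/IHk|/eqP]. Qed.

Lemma SetFlagsP c v k s : pos s 0 = 0 -> trk (sem (SetFlags c v k) s) RM 0 =
  if has (fun j => pos s (c j) == pos s X) (iota 0 k) then v else trk s RM 0.
Proof.
move=> p0; elim: k => // k IHk; rewrite -addn1 iotaD has_cat /= orbF.
have fr h : pos (sem (SetFlags c v k) s) h = pos s h by rewrite sem_mod_heads // mod_heads_SetFlags.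
rewrite addn1 [SetFlags _ _ _]/=; exec; rewrite !fr p0.
case: eqP => _; first by rewrite orbT.
by rewrite orbF.
Qed.

Section RemPass.
Variable k : nat.

(** Switching off comes second, so a pointer still at the start of its sequence yields an empty
    interval. *)
Definition RemStep := SetFlags seg true k ;; SetFlags ptr false k ;;
  IfB RM (Put X REM true) (Put X REM false).
Definition RemPass := SetB RM false ;; For X RemStep.

Definition passed (sj hj : nat -> nat) i := has (fun j => sj j <= i < hj j) (iota 0 k).

Lemma mod_heads_RemPass : mod_heads RemPass = [:: 2].
Proof. by rewrite /= !mod_heads_SetFlags. Qed.

Lemma mod_tracks_RemPass x : x \in mod_tracks RemPass -> x = 5 \/ x = 15.
Proof.
rewrite /= !inE !mem_cat !inE => /orP[/eqP|/orP[/mod_tracks_SetFlags|/orP[/mod_tracks_SetFlags|/orP[]/eqP]]];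
by [left|right].
Qed.

(** One flag serves all [k] intervals because each is closed before the next one opens. *)
Lemma RemPassP w st sj hj : holds_input w st ->
  (forall j, j < k -> pos st (seg j) = sj j /\ pos st (ptr j) = hj j) ->
  (forall j, j < k -> sj j <= hj j) ->
  (forall j j', j < j' < k -> hj j < sj j') ->
  forall i, i <= size w -> trk (sem RemPass st) REM i = passed sj hj i.
Proof.
move=> ist hst hle hlt; rewrite /RemPass; exec; set s0 := setk _ _ _ _.
have [p0 eN _] := ist; have e1 : pos s0 1 = size w by [].
pose I i s := [/\ pos s 0 = 0, forall j, j < k -> pos s (seg j) = sj j /\ pos s (ptr j) = hj j,
   trk s 15 0 = (0 < i) && passed sj hj i.-1 &
   forall i', i' < i -> trk s 5 i' = passed sj hj i'].
suff [_ _ _ h i hi] : I (pos s0 1).+1 (sem (For 2 RemStep) s0) by apply: h; rewrite e1.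
apply: for_ind => [|i s _ [q0 hs h15 h5]]; first by split; rewrite // !obsE p0.
have nt c v b : 5 \notin mod_tracks (SetFlags c v b) by apply/negP => /mod_tracks_SetFlags.
rewrite /RemStep; exec; set s1 := setp s 2 i.
set s2 := sem (SetFlags seg true k) s1; set s3 := sem (SetFlags ptr false k) s2.
have f2 h : pos s2 h = pos s1 h by rewrite /s2 sem_mod_heads // mod_heads_SetFlags.
have f3 h : pos s3 h = pos s1 h by rewrite /s3 sem_mod_heads // mod_heads_SetFlags.
have z1 : pos s1 0 = 0 by [].
have e15 : trk s3 15 0 = passed sj hj i.
  have h15' : trk s1 15 0 = (0 < i) && passed sj hj i.-1 by [].
  have x1 : pos s1 2 = i by [].
  rewrite SetFlagsP ?f2 // SetFlagsP // h15' x1.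
  have hsE j : j < k -> pos s1 (seg j) = sj j.
    by move=> hj'; rewrite !obsE (_ : (seg j == 2) = false) ?(hs j hj').1 // /seg; lia.
  have hhE j : j < k -> pos s2 (ptr j) = hj j.
    by move=> hj'; rewrite f2 !obsE (_ : (ptr j == 2) = false) ?(hs j hj').2 // /ptr; lia.
  case: hasP => [[j]|no1].
    rewrite mem_iota => hj'; rewrite hhE // => /eqP ei; apply/esym/hasP => -[j'].
    rewrite mem_iota => hj2 /andP[]; rewrite -ei => a1 a2.
    have le_j := hle j ltac:(lia); case: (ltngtP j j') => cj; last by subst j'; lia.
      by have := hlt j j' ltac:(lia); lia.
    by have := hlt j' j ltac:(lia); lia.
  case: hasP => [[j]|no2].
    rewrite mem_iota => hj'; rewrite hsE // => /eqP ei; apply/esym/hasP; exists j; rewrite ?mem_iota //.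
    have := hle j ltac:(lia); rewrite ei leqnn ltn_neqAle andTb => ->; rewrite andbT.
    suff /eqP : i <> hj j by case: eqP.
    by move=> ei2; case: no1; exists j; rewrite ?mem_iota // hhE // -ei2.
  case: (posnP i) => [i0|ip]; rewrite ?i0 /=.
    apply/esym/hasP => -[j]; rewrite mem_iota => hj' /andP[a1 _].
    by case: no2; exists j; rewrite ?mem_iota // hsE // i0 -leqn0.
  apply: eq_in_has => j; rewrite mem_iota => hj'.
  have n1 : hj j <> i by move=> e; case: no1; exists j; rewrite ?mem_iota // hhE // e.
  have n2 : sj j <> i by move=> e; case: no2; exists j; rewrite ?mem_iota // hsE // e.
  lia.
rewrite !f3 z1 e15 (_ : pos s1 2 = i); last by rewrite !obsE eqxx.
have pt a : (if a then setk s3 5 i true else setk s3 5 i false) = setk s3 5 i a by case: a.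
rewrite pt; split.
- by rewrite obsE f3.
- move=> j hj'; rewrite !pos_setk !f3 !pos_setp.
  have -> : (seg j == 2) = false by rewrite /seg; lia.
  have -> : (ptr j == 2) = false by rewrite /ptr; lia.
  exact: hs.
- by rewrite trk_setk /= e15.
move=> i' hi'; rewrite trk_setk eqxx /=; case: eqP => [->//|ne].
by rewrite !sem_mod_tracks // h5 //; lia.
Qed.

End RemPass.

(** * Counting open pallets *)

(** For the bin at [X], [OPN] records a remaining bin of the same pallet and [BAD] an earlier
    removed one. [BEF] is cleared before the comparison at [Y = X], so that no bin precedes
    itself. *)
Definition InnerStep := IfH X Y (SetB BEF false) Skip ;;
  IfT Y MARK (Same ;;
    IfB EQ (IfT Y REM (IfB BEF (SetB BAD true) Skip) (SetB OPN true)) Skip) Skip.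
Definition Inner := SetB OPN false ;; SetB BAD false ;; SetB BEF true ;; For Y InnerStep.
(** The comparison precedes the increment: [CNT] stays at [PLACES], and the first representative in
    excess raises [FAIL]. *)
Definition OuterStep := IfT X MARK (IfT X REM (Inner ;;
  IfB OPN (IfB BAD Skip (IfH CNT PLACES (SetB FAIL true) (Right CNT))) Skip) Skip) Skip.
Definition CountMarks := Copy CNT 0 ;; SetB FAIL false ;; For X OuterStep.

Section Count.
Variables (w : seq tk) (ms : seq nat) (rem : nat -> bool) (pal : nat -> nat) (P : nat).

Definition cctx s := [/\ holds_input w s, forall x, trk s MARK x = (x \in ms),
  forall x, x <= size w -> trk s REM x = rem x & pos s PLACES = P].

Hypothesis same : forall s, holds_input w s -> pos s X \in ms -> pos s Y \in ms ->
  trk (sem Same s) EQ 0 = (pal (pos s X) == pal (pos s Y)).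

Lemma cctx_sem s p : cctx s -> all (leq 2) (mod_heads p) -> 8 \notin mod_heads p ->
  all (leq 6) (mod_tracks p) -> cctx (sem p s).
Proof.
case=> is0 h4 h5 h8 hp h8' tp; have ntm x : x < 6 -> x \notin mod_tracks p.
  by move=> hx; apply/negP => /(allP tp); rewrite leqNgt hx.
split; rewrite ?sem_mod_heads //; last 2 [by move=> x; rewrite sem_mod_tracks ?ntm]; last by move=> x; rewrite sem_mod_tracks ?ntm //; apply: h5.
by apply: holds_input_sem => //; apply: sub_all tp => x; lia.
Qed.

Lemma cctx_setp s h i : cctx s -> h \notin [:: 0; 1; 8] -> cctx (setp s h i).
Proof.
case=> is0 h4 h5 h8 nh; split=> //; first by apply: holds_input_setp => //; move: nh; rewrite !inE; lia.
by rewrite pos_setp ifN // eq_sym; move: nh; rewrite !inE !negb_or => /and3P[].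
Qed.

Lemma cctx_setk s k i v : cctx s -> 5 < k -> cctx (setk s k i v).
Proof.
case=> is0 h4 h5 h8 hk; split=> // [|x|x hx]; first by apply: holds_input_setk => //; lia.
  by rewrite trk_setk (_ : (4 == k) = false) ?h4 //; lia.
by rewrite trk_setk (_ : (5 == k) = false) ?h5 //; lia.
Qed.

Definition has_open N x := has (fun y => [&& y \in ms, ~~ rem y & pal x == pal y]) (iota 0 N).
Definition has_prev N x :=
  has (fun y => [&& y < x, y \in ms, rem y & pal x == pal y]) (iota 0 N).

Lemma has_iotaS a n : has a (iota 0 n.+1) = has a (iota 0 n) || a n.
Proof. by rewrite -addn1 iotaD has_cat /= orbF. Qed.

Lemma InnerP s : cctx s -> pos s X \in ms ->
  trk (sem Inner s) OPN 0 = has_open (size w).+1 (pos s X) /\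
  trk (sem Inner s) BAD 0 = has_prev (size w).+1 (pos s X).
Proof.
move=> cs; have [[p0 pN _] _ _ _] := cs; move ex: (pos s 2) => x xm.
rewrite /Inner; exec; rewrite !pos_setk p0; set s0 := setk _ _ _ _.
have cs0 : cctx s0 by do 3!apply: cctx_setk => //.
have [[q0 eN _] _ _ _] := cs0.
pose I i s := [/\ cctx s, pos s 2 = x, trk s 12 0 = (i <= x),
  trk s 11 0 = has_open i x & trk s 13 0 = has_prev i x].
suff [_ _ _ -> ->] : I (pos s0 1).+1 (sem (For 3 InnerStep) s0) by rewrite eN.
apply: for_ind => [|i s1 hi [cs1 e2 h12 h11 h13]]; first by split.
rewrite eN in hi.
rewrite /InnerStep; exec; set s2 := setp s1 3 i.
have cs2 : cctx s2 by apply: cctx_setp.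
have [[r0 rN rk] r4 r5 r8] := cs2.
have x2 : pos s2 2 = x by []. 
have y2 : pos s2 3 = i by [].
rewrite x2 y2 r0; set s3 := (if i == x then _ else _).
have cs3 : cctx s3 by rewrite /s3; case: ifP => _ //; apply: cctx_setk.
have ps3 h : pos s3 h = pos s2 h by rewrite /s3; case: ifP.
have t12 : trk s3 12 0 = (i < x).
  by rewrite /s3 ltn_neqAle; case: eqP => [->|ne]; rewrite ?trk_setk //= trk_setp h12.
have t11 : trk s3 11 0 = has_open i x by rewrite /s3; case: ifP => _; rewrite ?trk_setk.
have t13 : trk s3 13 0 = has_prev i x by rewrite /s3; case: ifP => _; rewrite ?trk_setk.
have [is3 u4 u5 u8] := cs3; have [z0 _ _] := is3.
rewrite !ps3 y2 u4; case: (boolP (i \in ms)) => im; last first.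
  split; rewrite ?ps3 //; rewrite ?t12 ?t11 ?t13 /has_open /has_prev has_iotaS (negbTE im) /= ?andbF ?orbF //.
set s4 := sem Same s3.
have cs4 : cctx s4 by apply: cctx_sem.
have f4 h : h \notin [:: 4; 5; 6] -> pos s4 h = pos s2 h.
  by move=> nh; rewrite /s4 sem_mod_heads ?ps3 //; move: nh; rewrite /= !inE; lia.
have g4 k : k \notin [:: 8; 9] -> trk s4 k = trk s3 k.
  by move=> nh; rewrite /s4 sem_mod_tracks //; move: nh; rewrite /= !inE; lia.
have e9 : trk s4 9 0 = (pal x == pal i) by rewrite /s4 same ?ps3 ?x2 ?y2.
have [is4 v4 v5 v8] := cs4.
rewrite !f4 // r0 y2 e9 v5 // !g4 // t12.
case: eqP => epal; last first.
  split; rewrite ?f4 // ?g4 // ?t12 ?t11 ?t13 /has_open /has_prev has_iotaS;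
  rewrite (_ : (pal x == pal i) = false) ?andbF ?orbF //; exact/eqP.
case er : (rem i).
  case: ifP => ix.
    split; rewrite ?pos_setk ?trk_setk ?f4 ?g4 // ?t12 ?ix ?t11 /has_open /has_prev ?has_iotaS //=;
    rewrite ?im ?er ?ix ?epal ?eqxx /= ?orbF ?orbT //; exact: cctx_setk.
  split; rewrite ?f4 ?g4 // ?t12 ?ix ?t11 ?t13 /has_open /has_prev ?has_iotaS //;
  by rewrite ?im ?er ?ix ?epal ?eqxx /= ?orbF.
split; rewrite ?pos_setk ?trk_setk ?f4 ?g4 // ?t12 ?ix ?t13 /has_open /has_prev ?has_iotaS //=;
rewrite ?im ?er ?epal ?eqxx /= ?andbF ?orbF ?orbT //; exact: cctx_setk.
Qed.

(* [x] is the first removed bin of an open pallet. *)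
Definition counted x :=
  [&& x \in ms, rem x, has_open (size w).+1 x & ~~ has_prev (size w).+1 x].

Lemma CountMarksP s : cctx s ->
  trk (sem CountMarks s) FAIL 0 = (P < count counted (iota 0 (size w).+1)).
Proof.
move=> cs; have [[p0 pN _] _ _ _] := cs; rewrite /CountMarks; exec; set s0 := setk _ _ _ _.
have cs0 : cctx s0 by apply: cctx_setk => //; apply: cctx_setp.
have [[q0 eN _] _ _ _] := cs0.
pose I i s := [/\ cctx s, pos s 7 = minn P (count counted (iota 0 i)) &
   trk s 10 0 = (P < count counted (iota 0 i))].
suff [_ _ ->] : I (pos s0 1).+1 (sem (For 2 OuterStep) s0) by rewrite eN.
apply: for_ind => [|i s1 hi [cs1 e7 h10]].
  split; rewrite // /s0 ?trk_setk ?pos_setk pos_setp /= p0 ?minn0 //.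
rewrite eN in hi.
rewrite /OuterStep; exec; set s2 := setp s1 2 i.
have cs2 : cctx s2 by apply: cctx_setp.
have [[r0 rN rk] r4 r5 r8] := cs2.
have x2 : pos s2 2 = i by [].
have ci : count counted (iota 0 i.+1) = count counted (iota 0 i) + counted i.
  by rewrite -addn1 iotaD count_cat /= addn0.
rewrite /I ci; set c := count _ _ in e7 h10 *.
have stay s' : cctx s' -> pos s' 7 = pos s1 7 ->
   trk s' 10 0 = trk s1 10 0 -> counted i = false ->
   [/\ cctx s', pos s' 7 = minn P (c + counted i) & trk s' 10 0 = (P < c + counted i)].
  by move=> cs' f g ->; rewrite addn0 f // g.
rewrite x2 r4 r5 //.
case im : (i \in ms); last by apply: stay; rewrite // /counted im.
case er : (rem i); last by apply: stay; rewrite // /counted im er.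
have [] := @InnerP s2 cs2; rewrite x2 // => eo eb.
set s3 := sem Inner s2 in eo eb *.
have cs3 : cctx s3 by apply: cctx_sem.
have f3 h : h \notin [:: 3; 4; 5; 6] -> pos s3 h = pos s2 h.
  by move=> nh; rewrite /s3 sem_mod_heads //; move: nh; rewrite /= !inE; lia.
have g3 : trk s3 10 = trk s2 10 by rewrite /s3 sem_mod_tracks.
rewrite !f3 // r0 eo eb.
case ho : (has_open _ _); last first.
  by apply: stay; rewrite ?g3 ?f3 // /counted ?im ?er ?ho //.
case hb : (has_prev _ _).
  by apply: stay; rewrite ?g3 ?f3 // /counted ?im ?er ?ho ?hb //.
have e7' : pos s2 7 = minn P c by [].
have -> : counted i = true by rewrite /counted im er ho hb.
rewrite r8 e7' /= addn1; case: eqP => hP; split.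
- exact: cctx_setk.
- by rewrite pos_setk f3 // e7'; lia.
- by rewrite trk_setk /=; lia.
- exact: cctx_setp.
- by rewrite pos_setp /=; lia.
by rewrite trk_setp g3 [trk s2 10 0]h10; lia.
Qed.

End Count.

(** * Mixed radix indices and nested loops *)

Section Digits.
Variable N : nat.

Definition dig m j := (m %/ N.+1 ^ j) %% N.+1.

Lemma dig_le m j : dig m j <= N.
Proof. by rewrite -ltnS ltn_pmod. Qed.

Lemma powN_gt0 j : 0 < N.+1 ^ j. Proof. by rewrite expn_gt0. Qed.

Lemma dig_block q i j : i < N.+1 -> dig ((q * N.+1 + i) * N.+1 ^ j) j = i.
Proof. by move=> hi; rewrite /dig mulnK ?powN_gt0 // modnMDl modn_small. Qed.

Lemma dig_above q i j l : i < N.+1 -> j < l ->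
  dig ((q * N.+1 + i) * N.+1 ^ j) l = dig (q * N.+1 ^ j.+1) l.
Proof.
move=> hi hl; rewrite /dig (_ : l = j + (1 + (l - j.+1))); last lia.
rewrite !expnD expn1 !divnMA expnS mulnA !mulnK ?powN_gt0 //.
by rewrite divnMDl // (divn_small hi) addn0.
Qed.

Lemma dig_incr m j l : dig m j < N -> dig (m + N.+1 ^ j) l = dig m l + (l == j).
Proof.
move=> head_cell; rewrite /dig; case: (ltngtP l j) => hlj.
- rewrite (_ : j = l + (1 + (j - l.+1))); last lia.
  rewrite !expnD expn1 divnDr ?dvdn_mulr // mulKn ?powN_gt0 //.
  by rewrite mulnC -modnDmr modnMl addn0 addn0.
- rewrite (_ : l = j + (1 + (l - j.+1))); last lia.
  rewrite !expnD expn1 !divnMA divnDr // divnn powN_gt0 addn0; congr (_ %/ _ %% _).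
  rewrite {1}(divn_eq (m %/ N.+1 ^ j) N.+1) -addnA divnMDl //.
  by rewrite [X in _ + X]divn_small ?addn0 // addn1 ltnS.
rewrite hlj divnDr // divnn powN_gt0 -modnDml modn_small //.
by rewrite addn1 ltnS.
Qed.

Lemma incr_lt m j K : m < N.+1 ^ K -> j < K -> dig m j < N -> m + N.+1 ^ j < N.+1 ^ K.
Proof.
move=> hm hj head_cell; have eK : N.+1 ^ K = N.+1 ^ j * N.+1 * N.+1 ^ (K - j.+1).
  by rewrite -expnSr -expnD; congr (_ ^ _); lia.
have e0 : m %/ N.+1 ^ K = 0 by rewrite divn_small.
suff : (m + N.+1 ^ j) %/ N.+1 ^ K = 0.
  by move/eqP; rewrite -leqn0 leqNgt divn_gt0 ?powN_gt0 // -ltnNge.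
rewrite -e0 eK !divnMA divnDr // divnn powN_gt0; congr (_ %/ _).
rewrite {1}(divn_eq (m %/ N.+1 ^ j) N.+1) -addnA divnMDl //.
by rewrite [X in _ + X]divn_small ?addn0 // addn1 ltnS.
Qed.

Lemma decr_dig m j : 0 < dig m j -> N.+1 ^ j <= m.
Proof.
move=> head_cell; rewrite leqNgt; apply/negP => hm; move: head_cell; rewrite /dig divn_small //.
Qed.

Lemma dig_decr m j l : 0 < dig m j -> dig (m - N.+1 ^ j) l = dig m l - (l == j).
Proof.
move=> head_cell; have hm := decr_dig head_cell; set m1 := m - _.
have em : m = m1 + N.+1 ^ j by rewrite /m1; lia.
suff hN : dig m1 j < N by rewrite [in RHS]em dig_incr //; lia.
(* Were this digit [N], adding the power would carry and leave 0 as digit [j] of [m]. *)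
rewrite ltn_neqAle dig_le andbT; apply/eqP => e.
move: head_cell; rewrite em /dig divnDr // divnn powN_gt0 -modnDml.
by rewrite -[(m1 %/ _) %% _]/(dig m1 j) e addn1 modnn.
Qed.

Lemma dig_exists K h : (forall j, j < K -> h j <= N) ->
  exists2 m, m < N.+1 ^ K & forall j, j < K -> dig m j = h j.
Proof.
elim: K => [|K IHK] le_h; first by exists 0.
have [j|m hm head_cell] := IHK; first by move=> hj; apply: le_h; lia.
have hK : h K <= N by apply: le_h.
exists (h K * N.+1 ^ K + m) => [|j hj].
  by rewrite expnS; have := hm; nia.
case: (ltnP j K) => hjK.
  have eK : h K * N.+1 ^ K = h K * N.+1 ^ (K - j.+1) * N.+1 * N.+1 ^ j.
    by rewrite -!mulnA -expnS -expnD; congr (_ * _ ^ _); lia.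
  by rewrite -(head_cell j hjK) /dig eK divnMDl ?powN_gt0 // modnMDl.
have -> : j = K by lia.
by rewrite /dig divnMDl ?powN_gt0 // divn_small // addn0 modn_small.
Qed.

End Digits.

(** The outermost loop drives the pointer of highest weight, so the body meets the tuples in the
    order of their numbers. *)
Fixpoint Loops j body := if j is j'.+1 then For (ptr j') (Loops j' body) else body.

Lemma mod_heads_Loops j body x : x \in mod_heads (Loops j body) ->
  x \in mod_heads body \/ exists2 i, i < j & x = ptr i.
Proof.
elim: j => [|j IHj] /=; first by left.
rewrite inE => /orP[/eqP ->|/IHj [|[i hi ->]]]; [right; exists j|left|right; exists i] => //; lia.
Qed.

Lemma mod_tracks_Loops j body : mod_tracks (Loops j body) = mod_tracks body.
Proof. by elim: j. Qed.

Lemma Loops_ind (I : nat -> state -> Prop) N K body s :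
  (forall j, j < K -> ptr j \notin mod_heads body) -> 1 \notin mod_heads body ->
  (forall m s j i, j < K -> I m s -> I m (setp s (ptr j) i)) ->
  (forall m s, m < N.+1 ^ K -> I m s -> (forall j, j < K -> pos s (ptr j) = dig N m j) ->
     I m.+1 (sem body s)) ->
  pos s 1 = N -> I 0 s -> I (N.+1 ^ K) (sem (Loops K body) s).
Proof.
move=> hb h1 hI hS.
(* While the outer pointers spell [q], the inner [j] loops cover the numbers from [q * N.+1 ^ j] up
   to, but excluding, [q.+1 * N.+1 ^ j]. *)
suff key j : j <= K -> forall q s, pos s 1 = N -> q.+1 * N.+1 ^ j <= N.+1 ^ K ->
    (forall i, j <= i < K -> pos s (ptr i) = dig N (q * N.+1 ^ j) i) ->
    I (q * N.+1 ^ j) s -> I (q.+1 * N.+1 ^ j) (sem (Loops j body) s).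
  move=> e1 I0; rewrite -[_ ^ K]mul1n; apply: key; rewrite ?mul1n // => i; lia.
elim: j => [|j IHj] hj q {}s e1 hq head_cell Iq.
  by rewrite !expn0 !muln1 in hq head_cell Iq *; apply: hS.
rewrite [Loops _ _]/=; pose I' i s := [/\ pos s 1 = N, I ((q * N.+1 + i) * N.+1 ^ j) s &
  forall l, j < l < K -> pos s (ptr l) = dig N (q * N.+1 ^ j.+1) l].
suff [_ h _] : I' (pos s 1).+1 (sem (For (ptr j) (Loops j body)) s).
  by move: h; rewrite e1 -mulSnr -mulnA -expnS.
apply: for_ind => [|i s1]; first by split; rewrite // addn0 -mulnA -expnS.
rewrite e1 => hi [f1 fI fd]; set s2 := setp s1 (ptr j) i.
have nh : ptr j != 1 by rewrite /ptr; lia.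
have g1 : pos s2 1 = N by rewrite pos_setp eq_sym (negbTE nh).
have hd2 l : j <= l < K -> pos s2 (ptr l) = dig N ((q * N.+1 + i) * N.+1 ^ j) l.
  case/andP=> jl lK; rewrite pos_setp; case: (ltngtP j l) jl => // [jl|<-] _.
    rewrite (_ : (ptr l == ptr j) = false); last by rewrite /ptr; lia.
    by rewrite dig_above // fd // jl.
  by rewrite eqxx dig_block.
have fr x : 1 = x \/ (exists2 l, j <= l < K & x = ptr l) -> x \notin mod_heads (Loops j body).
  move=> hx; apply/negP => /mod_heads_Loops [hxb|[l hl ex]].
    by case: hx hxb => [<-|[l /andP[_ lK] ->]]; apply/negP => //; apply: hb.
  case: hx => [|[l' hl']]; rewrite ex /ptr; lia.
split.
- by rewrite sem_mod_heads //; apply: fr; left.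
- rewrite addnS; apply: IHj => //; first exact: ltnW.
    apply: leq_trans hq; rewrite expnS mulnA leq_mul2r.
    by apply/orP; right; rewrite mulSn; lia.
  by apply: hI.
move=> l /andP[jl lK]; rewrite sem_mod_heads; last by apply: fr; right; exists l => //; lia.
rewrite pos_setp (_ : (ptr l == ptr j) = false) ?fd ?jl //; rewrite /ptr; lia.
Qed.

(** * The search program *)

Fixpoint AllIf (c : nat -> nat) j a :=
  if j is j'.+1 then If (ptr j') (c j') (AllIf c j' a) Skip else a.
(** A pointer on a [TSeq] has no successor, which confines it to its own sequence. *)
Fixpoint Push j := if j is j'.+1 then
  Push j' ;; IfT (ptr j') 3 Skip (Put (next_cell j') TBL true) else Skip.
Fixpoint Rights j := if j is j'.+1 then Rights j' ;; Right (next_cell j') else Skip.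
(** Powers of the base are obtained by counting: [j'] nested loops around one move bring the head to
    [N.+1 ^ j']. *)
Fixpoint InitT j := if j is j'.+1 then InitT j' ;; Loops j' (Right (next_cell j')) else Skip.

Definition Visit k := RemPass k ;; CountMarks ;;
  IfB FAIL Skip (AllIf (fun=> track_cell 3) k (SetB ANS true) ;; Push k).
Definition Core k := AllIf (fun j => head_cell (seg j)) k (Put CUR TBL true) ;;
  IfT CUR TBL (Visit k) Skip.
Definition Body k := Core k ;; Right CUR ;; Rights k.
Definition Main k := Places ;; Starts k.-1 ;; Marks ;; InitT k ;; Loops k (Body k).

Lemma iota_rcons j : iota 0 j.+1 = rcons (iota 0 j) j.
Proof. by rewrite -addn1 iotaD cats1. Qed.

Lemma AllIfP c j a s : sem (AllIf c j a) s =
  if all (fun i => cell s (c i) (pos s (ptr i))) (iota 0 j) then sem a s else s.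
Proof.
elim: j => // j IHj; rewrite iota_rcons all_rcons.
have -> : sem (AllIf c j.+1 a) s = if cell s (c j) (pos s (ptr j)) then sem (AllIf c j a) s else s.
  by [].
by rewrite IHj; case: (cell _ _ _).
Qed.

Lemma mod_heads_AllIf c j a x : x \in mod_heads (AllIf c j a) -> x \in mod_heads a.
Proof. by elim: j => //= j IHj; rewrite cats0. Qed.

Lemma mod_tracks_AllIf c j a x : x \in mod_tracks (AllIf c j a) -> x \in mod_tracks a.
Proof. by elim: j => //= j IHj; rewrite cats0. Qed.

Lemma mod_heads_Push j : mod_heads (Push j) = [::].
Proof. by elim: j => //= j ->. Qed.

Lemma mod_tracks_Push j x : x \in mod_tracks (Push j) -> x = 6.
Proof. by elim: j => //= j IHj; rewrite mem_cat inE => /orP[/IHj|/eqP]. Qed.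

Lemma PushP j s x : trk (sem (Push j) s) TBL x = trk s TBL x ||
  has (fun i => ~~ trk s 3 (pos s (ptr i)) && (x == pos s (next_cell i))) (iota 0 j).
Proof.
elim: j => [|j IHj]; first by rewrite orbF.
rewrite iota_rcons has_rcons orbCA -IHj [Push _]/=; exec.
have fr h : pos (sem (Push j) s) h = pos s h by rewrite sem_mod_heads // mod_heads_Push.
rewrite !fr sem_mod_tracks; last by apply/negP => /mod_tracks_Push.
by case: ifP => _ //=; rewrite trk_setk; case: eqP.
Qed.

Lemma mod_heads_Rights j x : x \in mod_heads (Rights j) -> exists2 i, i < j & x = next_cell i.
Proof.
elim: j => //= j IHj; rewrite mem_cat inE => /orP[/IHj[i hi ->]|/eqP ->]; last by exists j.
by exists i => //; apply: ltnW.
Qed.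

Lemma mod_tracks_Rights j : mod_tracks (Rights j) = [::].
Proof. by elim: j => //= j ->. Qed.

Lemma tt_neq i j : i < j -> (next_cell i == next_cell j) = false.
Proof. by rewrite /next_cell; lia. Qed.

Lemma RightsP j s i : i < j -> pos (sem (Rights j) s) (next_cell i) = (pos s (next_cell i)).+1.
Proof.
elim: j => // j IHj hi; rewrite [Rights _]/=; exec; rewrite pos_setp.
have nj : next_cell j \notin mod_heads (Rights j).
  by apply/negP => /mod_heads_Rights [l hl /eqP]; rewrite eq_sym tt_neq.
case: (ltngtP i j) hi => [ij _|ji|-> _]; last by rewrite eqxx sem_mod_heads.
  by rewrite tt_neq // IHj.
by rewrite ltnS leqNgt ji.
Qed.

Lemma mod_heads_CountMarks x : x \in mod_heads CountMarks -> 1 < x < 8.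
Proof. by move=> hx; have /allP/(_ x hx) : all (fun x => 1 < x < 8) (mod_heads CountMarks) by []. Qed.

Lemma mod_tracks_CountMarks x : x \in mod_tracks CountMarks -> 4 < x.
Proof. by move=> hx; have /allP/(_ x hx) : all (fun x => 4 < x) (mod_tracks CountMarks) by []. Qed.

Lemma mod_heads_Visit k x : x \in mod_heads (Visit k) -> 1 < x < 8.
Proof.
rewrite -[mod_heads _]/(mod_heads (RemPass k) ++ mod_heads CountMarks ++
  mod_heads (AllIf (fun=> track_cell 3) k (SetB ANS true)) ++ mod_heads (Push k)).
rewrite mod_heads_RemPass mod_heads_Push cats0 mem_cat => /orP[|].
  by rewrite inE => /eqP ->.
by rewrite mem_cat => /orP[/mod_heads_CountMarks|/mod_heads_AllIf].
Qed.

Lemma mod_tracks_Visit k x : x \in mod_tracks (Visit k) -> 4 < x.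
Proof.
rewrite -[mod_tracks _]/(mod_tracks (RemPass k) ++ mod_tracks CountMarks ++
  mod_tracks (AllIf (fun=> track_cell 3) k (SetB ANS true)) ++ mod_tracks (Push k)).
rewrite mem_cat => /orP[/mod_tracks_RemPass [] -> //|].
rewrite mem_cat => /orP[/mod_tracks_CountMarks //|].
rewrite mem_cat => /orP[/mod_tracks_AllIf|/mod_tracks_Push -> //].
by rewrite inE => /eqP ->.
Qed.

Lemma mod_heads_Core k x : x \in mod_heads (Core k) -> 1 < x < 8.
Proof.
by rewrite [mod_heads _]/= cats0 mem_cat => /orP[/mod_heads_AllIf|/mod_heads_Visit].
Qed.

Lemma mod_tracks_Core k x : x \in mod_tracks (Core k) -> 4 < x.
Proof.
rewrite [mod_tracks _]/= cats0 mem_cat => /orP[/mod_tracks_AllIf|/mod_tracks_Visit //].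
by rewrite inE => /eqP ->.
Qed.

Lemma mod_heads_Body k x : x \in mod_heads (Body k) -> [\/ 1 < x < 8, x = 11 | exists2 i, i < k & x = next_cell i].
Proof.
rewrite [mod_heads _]/= mem_cat inE => /orP[/mod_heads_Core|/orP[/eqP|/mod_heads_Rights]];
by [apply: Or31 | apply: Or32 | apply: Or33].
Qed.

(** * Invariant of the pass over all tuples *)

Section Search.
Variables (w : seq tk) (k : nat) (ms : seq nat) (pal : nat -> nat) (P : nat).
Variables (sj fj : nat -> nat).
Local Notation N := (size w).
Local Notation B := (size w).+1.

Hypothesis same : forall s, holds_input w s -> pos s X \in ms -> pos s Y \in ms ->
  trk (sem Same s) EQ 0 = (pal (pos s X) == pal (pos s Y)).
Hypothesis le_sf : forall j, j < k -> sj j <= fj j.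
Hypothesis lt_fs : forall j j', j < j' < k -> fj j < sj j'.
Hypothesis lt_fN : forall j, j < k -> fj j < N.

Definition seqend i := (i < N) && (nth T0 w i == TSeq).
Hypothesis end_f : forall j, j < k -> seqend (fj j).

Definition okm m := count (counted w ms (passed k sj (dig N m)) pal) (iota 0 B) <= P.
Definition initial m := all (fun j => sj j == dig N m j) (iota 0 k).
Definition final m := all (fun j => seqend (dig N m j)) (iota 0 k).
Definition pushes m x := has (fun j => ~~ seqend (dig N m j) && (x == m + B ^ j)) (iota 0 k).

(** The bound is tested on leaving a tuple, since the program counts open pallets only when visiting
    it. A final tuple thus needs its own test [okm]. *)
Inductive reachable_index : nat -> Prop :=
| RI_initial m : m < B ^ k -> initial m -> reachable_index m
| RI_push m x : reachable_index m -> okm m -> pushes m x -> reachable_index x.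

(** A pointer at [fj j] is never advanced, so every digit that is increased lies below [N] and no
    addition carries. *)
Lemma RI_valid m : reachable_index m -> m < B ^ k /\ forall j, j < k -> sj j <= dig N m j <= fj j.
Proof.
elim=> {m} [m hm /allP hi|m x _ [hm hv] _ /hasP[j]].
  split=> // j hj; have := hi j; rewrite mem_iota => /(_ hj) /eqP <-.
  by rewrite leqnn le_sf.
rewrite mem_iota /= => hj /andP[ne /eqP ->].
have lt_f : dig N m j < fj j.
  rewrite ltn_neqAle (andP (hv j hj)).2 andbT; apply: contraNneq ne => ->.
  exact: end_f.
have lt_N : dig N m j < N by apply: ltn_trans (lt_fN hj).
split=> [|l hl]; first exact: incr_lt.
by rewrite dig_incr //; have := hv l hl; case: eqP => [->|_]; lia.
Qed.

Definition mctx s := [/\ holds_input w s, forall x, trk s MARK x = (x \in ms), pos s PLACES = P &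
  forall j, j < k -> pos s (seg j) = sj j].

Lemma mctx_sem p s : mctx s -> (forall x, x \in mod_heads p -> [/\ 1 < x, x != 8 & forall j, x != seg j]) ->
  (forall x, x \in mod_tracks p -> 4 < x) -> mctx (sem p s).
Proof.
move=> [is0 h4 h8 hs] hp tp; split.
- apply: holds_input_sem => //; apply/allP => x; first by case/hp.
  by move/tp/ltnW.
- by move=> x; rewrite sem_mod_tracks //; apply/negP => /tp.
- by rewrite sem_mod_heads //; apply/negP => /hp[].
by move=> j hj; rewrite sem_mod_heads ?hs //; apply/negP => /hp[_ _ /(_ j)]; rewrite eqxx.
Qed.

Lemma seqendE s i : holds_input w s -> trk s 3 i = seqend i.
Proof. by case=> _ _ ->; rewrite // /seqend; case: (nth T0 w i). Qed.

Lemma VisitP m s : mctx s -> reachable_index m -> (forall j, j < k -> pos s (ptr j) = dig N m j) ->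
  (forall j, j < k -> pos s (next_cell j) = m + B ^ j) ->
  (forall x, trk (sem (Visit k) s) TBL x = trk s TBL x || okm m && pushes m x) /\
  trk (sem (Visit k) s) ANS 0 = trk s ANS 0 || okm m && final m.
Proof.
move=> [is0 h4 h8 hs] Rm hh0 ht; have [hm hv] := RI_valid Rm.
rewrite /Visit; exec; set s1 := sem (RemPass k) s; set s2 := sem CountMarks s1.
have f1 h : h != 2 -> pos s1 h = pos s h by move=> ?; rewrite /s1 sem_mod_heads // mod_heads_RemPass inE.
have f2 h : (h < 2) || (7 < h) -> pos s2 h = pos s h.
  move=> hlt; rewrite /s2 sem_mod_heads ?f1 //; first by lia.
  by apply: contraL hlt => /mod_heads_CountMarks; lia.
have g1 x : x \notin [:: 5; 15] -> trk s1 x = trk s x.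
  by move=> hx; rewrite /s1 sem_mod_tracks //; apply: contra hx => /mod_tracks_RemPass [] ->.
have is1 : holds_input w s1.
  apply: holds_input_sem => //; rewrite ?mod_heads_RemPass //.
  by apply/allP => x /mod_tracks_RemPass [] ->.
have is2 : holds_input w s2 by apply: holds_input_sem.
have cc : cctx w ms (passed k sj (dig N m)) P s1.
  split=> //; first by move=> x; rewrite g1.
    move=> x hx; rewrite /s1; apply: RemPassP is0 _ _ _ x hx => j.
    - by move=> hj; rewrite hs ?hh0.
    - by move=> hj; case/andP: (hv j hj).
    move=> j' /andP[jj' hj']; have := hv j (ltn_trans jj' hj'); have := @lt_fs j j'.
    by rewrite jj' hj' => /(_ isT); lia.
  by rewrite f1.
have [q0 _ _] := is2.
have tbl x : trk s2 6 x = trk s 6 x by rewrite /s2 sem_mod_tracks // g1.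
have ans x : trk s2 7 x = trk s 7 x by rewrite /s2 sem_mod_tracks // g1.
rewrite q0 (CountMarksP same cc) ltnNge -/(okm m); case: (okm m); last first.
  by split=> [x|]; rewrite ?tbl ?ans orbF.
rewrite /= AllIfP; have hE j : j < k -> pos s2 (ptr j) = dig N m j.
  by move=> hj; rewrite f2 ?hh0 // /ptr; lia.
rewrite (eq_in_all (a2 := fun j => seqend (dig N m j))); last first.
  by move=> j; rewrite mem_iota => hj; rewrite cell_tr hE // (seqendE _ is2).
rewrite -/(final m); set s3 := if _ then _ else _.
have p3 h : pos s3 h = pos s2 h by rewrite /s3; case: ifP.
have t3 : trk s3 3 = trk s2 3 by rewrite /s3; case: ifP.
have t6 : trk s3 6 = trk s2 6 by rewrite /s3; case: ifP.
split=> [x|].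
  rewrite PushP t6 tbl; congr (_ || _); apply: eq_in_has => j; rewrite mem_iota => hj.
  by rewrite !p3 t3 hE // (seqendE _ is2) f2 ?ht // /next_cell; lia.
rewrite sem_mod_tracks; last by apply/negP => /mod_tracks_Push.
by rewrite /s3; case: ifP => _; rewrite ?orbT ?orbF ?ans // sem_Put trk_setk q0.
Qed.

(* Every predecessor of a tuple has a smaller number, so entry [m] of the table is final
   when the loops reach [m]. *)
Definition tbl_inv m x := (x < m /\ x < B ^ k /\ initial x) \/
  exists m', [/\ m' < m, reachable_index m', okm m' & pushes m' x].
Definition ans_inv m := exists m', [/\ m' < m, reachable_index m', okm m' & final m'].

(** The heads [ptr j] are left out: the loops reset them between two rounds, and [Loops_ind]
    supplies their positions. *)
Definition search_inv m s := [/\ mctx s, pos s CUR = m,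
  forall j, j < k -> pos s (next_cell j) = m + B ^ j,
  forall x, trk s TBL x <-> tbl_inv m x & trk s ANS 0 <-> ans_inv m].

Lemma CoreP m s : m < B ^ k -> search_inv m s ->
  (forall j, j < k -> pos s (ptr j) = dig N m j) ->
  (forall x, trk (sem (Core k) s) TBL x <-> tbl_inv m.+1 x) /\
  (trk (sem (Core k) s) ANS 0 <-> ans_inv m.+1).
Proof.
move=> hm [cs ec ht htbl hans] hd0; have [is0 h4 h8 hs] := cs.
rewrite /Core; exec; rewrite AllIfP (eq_in_all (a2 := fun j => sj j == dig N m j)); last first.
  by move=> j; rewrite mem_iota => hj; rewrite cell_hd hs // hd0.
rewrite -/(initial m) sem_Put; set s1 := (if initial m then _ else _).
have p1 h : pos s1 h = pos s h by rewrite /s1; case: (initial m).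
have cs1 : mctx s1.
  rewrite /s1; case: (initial m) => //; apply: (mctx_sem (p := Put 11 6 true)) => // x.
  by rewrite inE => /eqP ->.
have T1 x : trk s1 6 x <-> trk s 6 x \/ x = m /\ initial m.
  rewrite /s1; case hi: (initial m); last by split; [left | case=> // -[]].
  rewrite ?sem_Put trk_setk eqxx ec; case: eqP => [->|ne] /=; first by split => // _; right.
  by split; [left | case=> // -[]].
have RIm : trk s1 6 m <-> reachable_index m.
  rewrite T1 htbl; split.
    case=> [[[]|[m' [_ Rm' om' pm']]]|[_ im]]; first by rewrite ltnn.
      exact: RI_push pm'.
    exact: RI_initial.
  case=> [m1 _ im|m1 x R1 o1 p1']; first by right.
  left; right; exists m1; split=> //; case/hasP: p1' => j _ /andP[_ /eqP ->].
  by rewrite -addn1 leq_add2l powN_gt0.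
have a1 : trk s1 7 0 = trk s 7 0 by rewrite /s1; case: (initial m).
rewrite p1 ec; case: ifP => hT.
  have Rm := proj1 RIm hT.
  have [||tb an] := VisitP cs1 Rm; try by move=> j hj; rewrite p1 ?hd0 ?ht.
  split=> [x|].
    rewrite tb; split.
      case/orP => [/T1[/htbl [[a [b c]]|[m' [a b c d]]]|[-> im]]|/andP[om pm]].
      - by left; split=> //; apply: ltnW.
      - by right; exists m'; split=> //; apply: ltnW.
      - by left.
      by right; exists m.
    case=> [[lt [lt2 ix]]|[m' [lt R' o' p']]].
      apply/orP; left; apply/T1; rewrite ltnS leq_eqVlt in lt.
      case/orP: lt => [/eqP e|lt]; first by right; rewrite -e.
      by left; apply/htbl; left.
    rewrite ltnS leq_eqVlt in lt; apply/orP.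
    case/orP: lt => [/eqP e|lt]; first by right; rewrite -e o'.
    by left; apply/T1; left; apply/htbl; right; exists m'.
  rewrite an a1; split.
    case/orP => [/hans [m' [a b c d]]|/andP[om fm]]; last by exists m.
    by exists m'; split=> //; apply: ltnW.
  case=> m' [lt R' o' f']; rewrite ltnS leq_eqVlt in lt; apply/orP.
  case/orP: lt => [/eqP e|lt]; first by right; rewrite -e o'.
  by left; apply/hans; exists m'.
(* An unmarked tuple is skipped; being unreachable, it contributes nothing to either invariant. *)
have nRm : ~ reachable_index m by move/RIm; rewrite hT.
split=> [x|].
  rewrite T1 htbl; split.
    case=> [[[a [b c]]|[m' [a b c d]]]|[-> im]]; last by left.
      by left; split=> //; apply: ltnW.
    by right; exists m'; split=> //; apply: ltnW.
  case=> [[lt [lt2 ix]]|[m' [lt R' o' p']]]; rewrite ltnS leq_eqVlt in lt.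
    case/orP: lt => [/eqP e|lt]; first by right; rewrite -e.
    by left; left.
  case/orP: lt => [/eqP e|lt]; first by case: nRm; rewrite -e.
  by left; right; exists m'.
rewrite a1 hans; split=> -[m' [lt R' o' f']]; exists m'; split=> //; first exact: ltnW.
rewrite ltnS leq_eqVlt in lt; case/orP: lt => [/eqP e|//].
by case: nRm; rewrite -e.
Qed.

Lemma BodyP m s : m < B ^ k -> search_inv m s ->
  (forall j, j < k -> pos s (ptr j) = dig N m j) -> search_inv m.+1 (sem (Body k) s).
Proof.
move=> mK inv hd0; have [tb an] := CoreP mK inv hd0; case: inv => cs ec ht _ _.
have fr h : 7 < h -> pos (sem (Core k) s) h = pos s h.
  by move=> hh8; rewrite sem_mod_heads //; apply/negP => /mod_heads_Core; lia.
have nR h : (forall i, h != next_cell i) -> h \notin mod_heads (Rights k).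
  by move=> hn; apply/negP => /mod_heads_Rights [i _ e]; have := hn i; rewrite e eqxx.
split.
- apply: mctx_sem => // x; last first.
    by rewrite [mod_tracks _]/= mod_tracks_Rights cats0; apply: mod_tracks_Core.
  by case/mod_heads_Body => [hx|->|[i _ ->]]; rewrite ?/next_cell; split; first [lia | by move=> j; rewrite /seg; lia].
- rewrite /Body; exec; rewrite sem_mod_heads; last by apply: nR => i; rewrite /next_cell; lia.
  by rewrite pos_setp eqxx fr // ec.
- move=> j hj; rewrite /Body; exec; rewrite RightsP // pos_setp.
  rewrite (_ : (next_cell j == 11) = false); last by rewrite /next_cell; lia.
  by rewrite fr ?ht //; rewrite /next_cell; lia.
- by move=> x; rewrite /Body; exec; rewrite sem_mod_tracks ?mod_tracks_Rights // trk_setp; apply: tb.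
by rewrite /Body; exec; rewrite sem_mod_tracks ?mod_tracks_Rights // trk_setp.
Qed.

End Search.

(** * Correctness of the search program *)

Lemma mod_heads_InitT j x : x \in mod_heads (InitT j) -> exists2 i, i < j & x = next_cell i \/ x = ptr i.
Proof.
elim: j => //= j IHj; rewrite mem_cat => /orP[/IHj [i hi h]|/mod_heads_Loops [|[i hi ->]]].
- by exists i => //; apply: ltnW.
- by rewrite inE => /eqP ->; exists j => //; left.
by exists i; [apply: ltnW | right].
Qed.

Lemma mod_tracks_InitT j : mod_tracks (InitT j) = [::].
Proof. by elim: j => //= j ->; rewrite mod_tracks_Loops. Qed.

Lemma InitTP N j s : pos s 1 = N -> (forall i, pos s (next_cell i) = 0) ->
  forall i, i < j -> pos (sem (InitT j) s) (next_cell i) = N.+1 ^ i.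
Proof.
move=> e1 e0; elim: j => // j IHj i hi; rewrite [InitT _]/=; exec.
set s1 := sem (InitT j) s.
have q1 : pos s1 1 = N.
  by rewrite /s1 sem_mod_heads //; apply/negP => /mod_heads_InitT [l _ []]; rewrite /next_cell /ptr; lia.
case: (ltngtP i j) hi => [ij _|ji|-> _]; last 1 first.
- pose I m s := pos s (next_cell j) = m.
  apply: (Loops_ind (I := I)) q1 _; rewrite /I.
  + by move=> l _; rewrite inE /ptr /next_cell; lia.
  + by rewrite inE /next_cell; lia.
  + move=> m s2 l v _ <-; rewrite pos_setp.
    by have -> : (next_cell j == ptr l) = false by rewrite /ptr /next_cell; lia.
  + by move=> m s2 _ <- _; exec; rewrite pos_setp eqxx.
  rewrite /s1 sem_mod_heads //; apply/negP => /mod_heads_InitT [l hl []]; rewrite /next_cell /ptr; lia.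
- rewrite sem_mod_heads ?IHj //; apply/negP => /mod_heads_Loops [|[i' _]].
    by rewrite inE => /eqP; rewrite /next_cell; lia.
  by rewrite /next_cell /ptr; lia.
by rewrite ltnS leqNgt ji.
Qed.

Lemma is_bits_bits f n : is_bits (bits_aux f n).
Proof.
rewrite /is_bits; elim: f n => //= f IHf n; case: eqP => //= _.
by rewrite IHf andbT; case: odd.
Qed.

Lemma bits_inj : injective bits.
Proof.
(* Decoding under the cap [m + n], large enough for both numbers, recovers each from its bits. *)
move=> m n e; have h x : (foldl (pstep (m + n)) (minn (m + n) 0, minn (m + n) 1) (bits x)).1
    = minn (m + n) x by rewrite foldl_pstep_bits // mul1n.
by have := h m; rewrite e h; lia.
Qed.

Lemma marks_seq_drop q o pre rest x b : (x, b) \in marks_seq o q -> size pre = o ->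
  exists r, drop x.+1 (pre ++ enc_seq q ++ rest) = bits (plt b) ++ TNum :: r.
Proof.
elim: q o pre => //= b' q IHq o pre; rewrite inE => /orP[/eqP [-> ->]|hx] so; last first.
  have [|r hr] := IHq _ (pre ++ enc_bin b') hx; first by rewrite size_cat so.
  by exists r; rewrite -hr enc_seq_cons -!catA.
exists (enc_seq q ++ rest); rewrite enc_seq_cons.
have -> : pre ++ (enc_bin b' ++ enc_seq q) ++ rest =
  (pre ++ bits b'.1 ++ [:: TNum]) ++ bits b'.2 ++ TNum :: (enc_seq q ++ rest).
  by rewrite /enc_bin /enc_num -!catA.
by rewrite drop_size_cat // !size_cat so /= addn1 addnS.
Qed.

Lemma marks_drop Q o pre rest x b : (x, b) \in marks o Q -> size pre = o ->
  exists r, drop x.+1 (pre ++ flatten (map enc_seq Q) ++ rest) = bits (plt b) ++ TNum :: r.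
Proof.
elim: Q o pre => //= q Q IHQ o pre; rewrite mem_cat => /orP[hx|hx] so.
  by have [r hr] := marks_seq_drop (flatten (map enc_seq Q) ++ rest) hx so; exists r; rewrite -hr -catA.
have [|r hr] := IHQ _ (pre ++ enc_seq q) hx; first by rewrite size_cat so.
by exists r; rewrite -hr -!catA.
Qed.

Section Correctness.
Variables (Q : seq (seq bin)) (p : nat).
Local Notation w := (enc_input Q p).
Local Notation k := (size Q).

Definition mark_pos := map fst (marks 0 Q).
Definition pallet_at x := plt (nth (0, 0) (map snd (marks 0 Q)) (index x mark_pos)).
(** The position of the [TSeq] that closes sequence [j]. *)
Definition finish j := start Q j + (size (enc_seq (nth [::] Q j))).-1.

Lemma pallet_at_mem x : x \in mark_pos ->
  exists2 b, (x, b) \in marks 0 Q & plt b = pallet_at x.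
Proof.
move=> hx; exists (nth (0, 0) (map snd (marks 0 Q)) (index x mark_pos)) => //.
set i := index _ _; have hi : i < size (marks 0 Q) by rewrite -(size_map fst) index_mem.
rewrite (nth_map (0, (0, 0))) //; have {1}<- : (nth (0, (0, 0)) (marks 0 Q) i).1 = x.
  by rewrite -(nth_map _ 0) // nth_index.
by rewrite -surjective_pairing mem_nth.
Qed.

Lemma same_pallet s : holds_input w s -> pos s X \in mark_pos -> pos s Y \in mark_pos ->
  trk (sem Same s) EQ 0 = (pallet_at (pos s X) == pallet_at (pos s Y)).
Proof.
move=> is0 /pallet_at_mem [b hb <-] /pallet_at_mem [b' hb' <-].
have [r hr] := marks_drop (enc_num p) hb (erefl (size [::])).
have [r' hr'] := marks_drop (enc_num p) hb' (erefl (size [::])).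
rewrite (SameP is0 _ _ hr hr'); try exact: is_bits_bits.
by apply/eqP/eqP => [/bits_inj|->].
Qed.

Lemma size_enc_seq q : 0 < size (enc_seq q).
Proof. by rewrite /enc_seq size_cat addn1. Qed.

Lemma finish_succ j : j < k -> (finish j).+1 = start Q j.+1.
Proof. by move=> hj; rewrite startS // /finish; have := size_enc_seq (nth [::] Q j); lia. Qed.

Lemma start_mono i j : i <= j -> j <= k -> start Q i <= start Q j.
Proof.
elim: j => [|j IHj]; first by rewrite leqn0 => /eqP ->.
rewrite leq_eqVlt => /orP[/eqP -> //|hij] hj.
by apply: leq_trans (IHj _ (ltnW hj)) _; rewrite ?startS ?leq_addr.
Qed.

Lemma start_le_finish j : j < k -> start Q j <= finish j.
Proof. by move=> _; apply: leq_addr. Qed.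

Lemma finish_lt_start j j' : j < j' < k -> finish j < start Q j'.
Proof.
case/andP=> jj' hj'; have hj := ltn_trans jj' hj'.
by rewrite finish_succ // start_mono // ltnW.
Qed.

Lemma start_size : start Q k = size (flatten (map enc_seq Q)).
Proof. by rewrite /start take_size. Qed.

Lemma finish_lt_size j : j < k -> finish j < size w.
Proof.
move=> hj; apply: (@leq_trans (start Q k)).
  by rewrite finish_succ // start_mono.
by rewrite start_size size_cat leq_addr.
Qed.

Lemma nth_segment j i : j < k -> i < size (enc_seq (nth [::] Q j)) ->
  nth T0 w (start Q j + i) = nth T0 (enc_seq (nth [::] Q j)) i.
Proof.
move=> hj hi; have [r hr] := drop_start p hj.
by rewrite -nth_drop hr nth_cat hi.
Qed.

Lemma seqend_finish j : j < k -> seqend w (finish j).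
Proof.
move=> hj; rewrite /seqend finish_lt_size //=.
rewrite nth_segment //; last by rewrite ltn_predL size_enc_seq.
by rewrite /enc_seq size_cat addn1 /= nth_cat ltnn subnn.
Qed.

Lemma seqend_inside j x : j < k -> start Q j <= x < finish j -> ~~ seqend w x.
Proof.
move=> hj /andP[h1 h2]; rewrite negb_and; apply/orP; right.
rewrite -(subnKC h1); set i := x - _.
have hi : i < (size (enc_seq (nth [::] Q j))).-1 by rewrite /i; move: h2; rewrite /finish; lia.
rewrite nth_segment //; last by lia.
move: hi; rewrite /enc_seq size_cat addn1 /= => hi; rewrite nth_cat hi.
by apply: contraNneq (no_TSeq_bins (nth [::] Q j)) => <-; apply: mem_nth.
Qed.

Local Notation reachable := (reachable_index w k mark_pos pallet_at (minn (size w) p) (start Q)).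
Local Notation few_open := (okm w k mark_pos pallet_at (minn (size w) p) (start Q)).

Lemma size_input : 0 < size w.
Proof. by rewrite /enc_input size_cat /enc_num size_cat /=; lia. Qed.

Hypothesis k0 : 0 < k.

Lemma MainP : trk (sem (Main k) (init_state w)) ANS 0 <->
  exists m, [/\ reachable m, few_open m & final w k m].
Proof.
have i0 := holds_input_init w; have w0 := size_input.
rewrite /Main; exec; set s1 := sem Places _; set s2 := sem (Starts _) _.
set s3 := sem Marks _; set s4 := sem (InitT _) _.
(* Token codes are below 4, so all working tracks start empty. *)
have t0 x i : 3 < x -> trk (init_state w) x i = false.
  by move=> hx; rewrite /= andbC; case: eqP => // e; move: hx; rewrite e; case: nth.
have i1 : holds_input w s1 by apply: holds_input_sem.
have hS x : x \in mod_heads (Starts k.-1) -> x = 4 \/ exists i, x = seg i.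
  by case/mod_heads_Starts => [|[i _ ->]]; [left | right; exists i].
have i2 : holds_input w s2.
  apply: holds_input_sem => //; apply/allP => x; last by move/mod_tracks_Starts ->.
  by case/hS => [->|[i ->]] //; rewrite /seg; lia.
have i3 : holds_input w s3 by apply: holds_input_sem.
have i4 : holds_input w s4.
  apply: holds_input_sem; rewrite ?mod_tracks_InitT //; apply/allP => x.
  by case/mod_heads_InitT => i _ []; rewrite /next_cell /ptr; lia.
have p1 h : 10 < h -> pos s1 h = pos (init_state w) h.
  by move=> hh0; rewrite /s1 sem_mod_heads // !inE; lia.
have p2 h : h != 4 -> (forall i, h != seg i) -> pos s2 h = pos s1 h.
  move=> h4 hn; rewrite /s2 sem_mod_heads //; apply/negP => /hS [/eqP|[i /eqP]]; last exact/negP.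
  exact/negP.
have p3 h : 7 < h -> pos s3 h = pos s2 h.
  by move=> hh0; rewrite /s3 sem_mod_heads // !inE; lia.
have p4 h : (forall i, h != next_cell i /\ h != ptr i) -> pos s4 h = pos s3 h.
  move=> hn; rewrite /s4 sem_mod_heads //; apply/negP => /mod_heads_InitT [i _]; have [/eqP h1 /eqP h2] := hn i.
  by case.
have q2 x i : x != 8 -> trk s2 x i = trk (init_state w) x i.
  move=> hx; rewrite /s2 sem_mod_tracks; last by apply: contra hx => /mod_tracks_Starts ->.
  by rewrite /s1 sem_mod_tracks // [mod_tracks _]/= !inE; lia.
have q4 x i : x \notin [:: 4; 8; 14] -> trk s4 x i = trk (init_state w) x i.
  rewrite !inE !negb_or => /and3P[h4 h8 h14].
  by rewrite /s4 sem_mod_tracks ?mod_tracks_InitT // /s3 sem_mod_tracks ?q2 // [mod_tracks _]/= !inE; lia.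
have I0 : search_inv w k mark_pos pallet_at (minn (size w) p) (start Q) 0 s4.
  split.
  - split=> //.
    + by move=> x; rewrite /s4 sem_mod_tracks ?mod_tracks_InitT //; apply: (MarksP i2) => [i|]; rewrite q2 // t0.
    + rewrite p4; last by move=> i; rewrite /next_cell /ptr; lia.
      rewrite p3 // p2 //; last by move=> i; rewrite /seg; lia.
      by rewrite /s1 (PlacesP i0 w0) foldl_pstep_input.
    move=> j hj; rewrite p4; last by move=> i; rewrite /seg /next_cell /ptr; lia.
    by rewrite p3 ?(StartsP i1) //; rewrite ?/seg; lia.
  - rewrite p4; last by move=> i; rewrite /next_cell /ptr; lia.
    by rewrite p3 // p2 ?p1 // => i; rewrite /seg; lia.
  - have e31 : pos s3 1 = size w by case: i3.
    have tt0 i : pos s3 (next_cell i) = 0.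
      rewrite p3 ?p2 ?p1 //; try by rewrite /next_cell; lia.
      + by rewrite /= ifN // /next_cell; lia.
      by move=> l; rewrite /next_cell /seg; lia.
    by move=> j hj; rewrite (InitTP e31 tt0 hj) add0n.
  - move=> x; rewrite q4 // t0 //; split=> // -[[//]|[m' [//]]].
  by rewrite q4 // t0 //; split=> // -[m' [//]].
have [_ _ _ _ ->] : search_inv w k mark_pos pallet_at (minn (size w) p) (start Q)
    ((size w).+1 ^ k) (sem (Loops k (Body k)) s4).
  apply: Loops_ind I0.
  - by move=> j _; apply/negP => /mod_heads_Body []; [| | case=> i _]; rewrite /ptr /next_cell; lia.
  - by apply/negP => /mod_heads_Body []; [| | case=> i _]; rewrite /next_cell; lia.
  - move=> m s j i hj [[j1 j2 j3 j4] jc jt jb ja].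
    have hh2 : 1 < ptr j by rewrite /ptr; lia.
    split=> //; last 2 first.
    + by rewrite pos_setp (_ : (11 == ptr j) = false) // /ptr; lia.
    + by move=> l hl; rewrite pos_setp (_ : (next_cell l == ptr j) = false) ?jt // /ptr /next_cell; lia.
    split=> //; first exact: holds_input_setp.
      by rewrite pos_setp (_ : (8 == ptr j) = false) // /ptr; lia.
    by move=> l hl; rewrite pos_setp (_ : (seg l == ptr j) = false) ?j4 // /ptr /seg; lia.
  - move=> m s hm' inv hd0; apply: (BodyP (fj := finish)) => //.
    + exact: same_pallet.
    + exact: start_le_finish.
    + exact: finish_lt_start.
    + exact: finish_lt_size.
    exact: seqend_finish.
  by case: i4.
split=> [[m [_ a b c]]|[m [a b c]]]; exists m => //; split=> //.
by have [] := RI_valid start_le_finish finish_lt_size seqend_finish a.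
Qed.

End Correctness.

(** * From token positions to configurations *)

Lemma mem_marks o Q xb : (xb \in marks o Q) =
  has (fun j => xb \in marks_seq (o + start Q j) (nth [::] Q j)) (iota 0 (size Q)).
Proof.
elim: Q o => //= q Q IHQ o; rewrite mem_cat IHQ start0 addn0; congr (_ || _).
rewrite -[1]addn0 iotaDl has_map; apply: eq_has => j /=.
by rewrite /start /= size_cat addnA.
Qed.

Lemma marks_seq_snd o q : map snd (marks_seq o q) = q.
Proof. by elim: q o => //= b q IHq o; rewrite IHq. Qed.

Lemma marks_seq_bounds o q x b : (x, b) \in marks_seq o q ->
  o <= x < o + (size (enc_seq q)).-1.
Proof.
elim: q o => //= b' q IHq o; rewrite enc_seq_cons size_cat inE.
have h1 := size_enc_seq q.
have h2 : size (bits b'.1) < size (enc_bin b').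
  by rewrite /enc_bin /enc_num !size_cat /=; lia.
by case/orP => [/eqP [-> _]|/IHq]; lia.
Qed.

(** Marks are listed by increasing position, so those before [x] form a prefix. A pointer position
    thereby becomes a cut of the sequence of bins. *)
Lemma marks_seq_filter o q x (M := marks_seq o q) (c := count (fun xb => xb.1 < x) M) :
  take c M = filter (fun xb => xb.1 < x) M /\ drop c M = filter (fun xb => x <= xb.1) M.
Proof.
rewrite /c /M {c M}; elim: q o => //= b q IHq o.
set o' := o + size (enc_bin b); have [h1 h2] := IHq o'.
case: (ltnP (o + size (bits b.1)) x) => hx /=; first by rewrite h1 h2.
have hall : all (fun xb => x <= xb.1) (marks_seq o' q).
  apply/allP => -[y b'] /marks_seq_bounds /andP[hy _] /=; apply: leq_trans hx _.
  apply: leq_trans hy; rewrite /o' leq_add2l /enc_bin /enc_num !size_cat; lia.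
have e0 : count (fun xb => xb.1 < x) (marks_seq o' q) = 0.
  apply/eqP; rewrite -leqn0 leqNgt -has_count; apply/hasPn => y /(allP hall).
  by rewrite -leqNgt.
rewrite e0 /= (all_filterP hall); split=> //.
by rewrite -h1 e0 take0.
Qed.

Lemma marks_seq_uniq o q : uniq (map fst (marks_seq o q)).
Proof.
elim: q o => //= b q IHq o; rewrite IHq andbT; apply/negP => /mapP [[y b'] /marks_seq_bounds].
move=> /= /andP[hy _] e; move: hy; rewrite -e /enc_bin /enc_num !size_cat /=; lia.
Qed.

Lemma marks_bounds o Q x b : (x, b) \in marks o Q -> o <= x.
Proof.
by rewrite mem_marks => /hasP [j _ /marks_seq_bounds /andP[h _]]; apply: leq_trans h; apply: leq_addr.
Qed.

Lemma marks_uniq o Q : uniq (map fst (marks o Q)).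
Proof.
elim: Q o => //= q Q IHQ o; rewrite map_cat cat_uniq marks_seq_uniq IHQ andbT /=.
apply/hasPn => y /mapP [[x b] /marks_bounds h ->] /=.
apply/negP => /mapP [[x' b'] /marks_seq_bounds /andP[_ h'] /= e].
by have := size_enc_seq q; lia.
Qed.

(** * Processings and pointer tuples *)

Section Reachability.
Variables (Q : seq (seq bin)) (p : nat).

(** The lists of configurations are replaced by an inductive predicate that gives access to the last
    transformation step. *)
Inductive place_reachable : seq (seq bin) -> Prop :=
| SR_start : num_open Q Q <= p -> place_reachable Q
| SR_step C C' : place_reachable C -> trans_step C C' -> num_open Q C' <= p -> place_reachable C'.

Lemma SR_open C : place_reachable C -> num_open Q C <= p.
Proof. by case. Qed.

Lemma solvableP : solvable Q p <-> exists2 C, place_reachable C & all_empty C.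
Proof.
split=> [[cs [[hs he] hu]]|[C hC he]].
  exists (last Q cs) => //; rewrite (last_nth Q).
  suff: forall j, j <= size cs -> place_reachable (nth Q (Q :: cs) j) by apply.
  elim=> [|j IHj] hj; first by apply: SR_start; apply: hu; rewrite mem_head.
  apply: SR_step (IHj (ltnW hj)) (hs _ hj) _.
  by apply: hu; rewrite inE mem_nth ?orbT.
suff [cs [hs hl hu]] : exists cs, [/\ forall j, j < size cs ->
    trans_step (nth Q (Q :: cs) j) (nth Q cs j), last Q cs = C & uses_at_most Q cs p].
  by exists cs; split=> //; split=> //; rewrite hl.
elim: hC {he} => [h0|C0 C' _ [cs [hs hl hu]] st hn].
  by exists [::]; split=> // C'; rewrite inE => /eqP ->.
exists (rcons cs C'); split; last 2 first.
- by rewrite last_rcons.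
- by move=> D; rewrite inE mem_rcons inE => /or3P[/eqP->|/eqP-> //|hD];
    apply: hu; rewrite inE ?eqxx ?hD ?orbT.
move=> j; rewrite size_rcons ltnS => hj; rewrite -rcons_cons !nth_rcons /= ltnS hj.
case: ltngtP hj => // [hj _|-> _]; first exact: hs.
by rewrite -last_nth hl.
Qed.

Local Notation w := (enc_input Q p).
Local Notation k := (size Q).
Local Notation N := (size w).

Definition marks_at j := marks_seq (start Q j) (nth [::] Q j).
Definition passed_at j x := count (fun xb => xb.1 < x) (marks_at j).
Definition conf (h : nat -> nat) := mkseq (fun j => drop (passed_at j (h j)) (nth [::] Q j)) k.
Definition valid (h : nat -> nat) := forall j, j < k -> start Q j <= h j <= finish Q j.

Lemma marks_at_bounds j x b : (x, b) \in marks_at j -> start Q j <= x < finish Q j.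
Proof. exact: marks_seq_bounds. Qed.

Lemma size_marks_at j : size (marks_at j) = size (nth [::] Q j).
Proof. by rewrite -(size_map snd) marks_seq_snd. Qed.

Lemma passed_at_le j x : passed_at j x <= size (nth [::] Q j).
Proof. by rewrite -size_marks_at count_size. Qed.

Lemma drop_passed j x : drop (passed_at j x) (nth [::] Q j) =
  map snd (filter (fun xb => x <= xb.1) (marks_at j)).
Proof. by rewrite -(marks_seq_filter _ _ _).2 map_drop marks_seq_snd. Qed.

Lemma take_passed j x : take (passed_at j x) (nth [::] Q j) =
  map snd (filter (fun xb => xb.1 < x) (marks_at j)).
Proof. by rewrite -(marks_seq_filter _ _ _).1 map_take marks_seq_snd. Qed.

Lemma pallet_atE x b : (x, b) \in marks 0 Q -> pallet_at Q x = plt b.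
Proof.
move=> hxb; have hx : x \in mark_pos Q by apply/mapP; exists (x, b).
have [b' hb' <-] := pallet_at_mem hx; congr plt.
have /(nthP (0, (0, 0))) [i hi ei] := hxb; have /(nthP (0, (0, 0))) [i' hi' ei'] := hb'.
suff ii : i = i' by rewrite ii ei' in ei; case: ei.
have := marks_uniq 0 Q => /(uniqP 0)/(_ i i'); rewrite !inE size_map.
by rewrite !(nth_map (0, (0, 0))) // ei ei'; apply.
Qed.

Lemma mem_marks0 xb : xb \in marks 0 Q <-> exists2 j, j < k & xb \in marks_at j.
Proof.
rewrite mem_marks; split=> [/hasP [j]|[j hj h]]; first by rewrite mem_iota; exists j.
by apply/hasP; exists j; rewrite ?mem_iota.
Qed.

Section Valid.
Variable h : nat -> nat.
Hypothesis hv : valid h.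
Local Notation rem := (passed k (start Q) h).

(** Segments are disjoint, so at a mark of sequence [j] only pointer [j] can account for the global
    flag. *)
Lemma rem_marks j x b : j < k -> (x, b) \in marks_at j -> rem x = (x < h j).
Proof.
move=> hj /marks_at_bounds /andP[h1 h2]; apply/hasP/idP => [[l]|hx]; last first.
  by exists j; rewrite ?mem_iota // h1.
rewrite mem_iota /= => hl /andP[h3 h4].
have /andP[_ h5] := hv hl; have /andP[h6 _] := hv hj.
case: (ltngtP l j) => lj; last by rewrite -lj.
  have := @finish_lt_start Q l j; rewrite lj hj => /(_ isT); lia.
have := @finish_lt_start Q j l; rewrite lj hl => /(_ isT); lia.
Qed.

Lemma mem_conf t : t \in map plt (flatten (conf h)) <->
  exists2 x, x \in mark_pos Q & ~~ rem x && (pallet_at Q x == t).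
Proof.
split.
  case/mapP => b /flattenP [s /(nthP [::]) [j]]; rewrite size_mkseq => hj <-.
  rewrite nth_mkseq // drop_passed => /mapP [[x b']]; rewrite mem_filter => /andP[hx hxb] -> ->.
  have hm : (x, b') \in marks 0 Q by apply/mem_marks0; exists j.
  exists x; first by apply/mapP; exists (x, b').
  by rewrite (rem_marks hj hxb) -leqNgt hx (pallet_atE hm) /=.
case=> x /mapP [[x' b] hm ->] /= /andP[hr /eqP <-]; rewrite (pallet_atE hm); apply: map_f.
have /mem_marks0 [j hj hxb] := hm; rewrite (rem_marks hj hxb) -leqNgt in hr.
apply/flattenP; exists (nth [::] (conf h) j); first by rewrite mem_nth // size_mkseq.
rewrite nth_mkseq // drop_passed; apply/mapP; exists (x', b) => //.
by rewrite mem_filter hr.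
Qed.

Lemma removed_conf : removed Q (conf h) =
  mkseq (fun j => take (passed_at j (h j)) (nth [::] Q j)) k.
Proof.
apply: (@eq_from_nth _ [::]); rewrite size_map size_zip !size_mkseq minnn // => j hj.
rewrite (nth_map ([::], [::])) ?size_zip ?size_mkseq ?minnn // nth_zip ?size_mkseq //.
rewrite !nth_mkseq //= size_drop subKn //; exact: passed_at_le.
Qed.

Lemma mem_removed t : t \in map plt (flatten (removed Q (conf h))) <->
  exists2 x, x \in mark_pos Q & rem x && (pallet_at Q x == t).
Proof.
rewrite removed_conf; split.
  case/mapP => b /flattenP [s /(nthP [::]) [j]]; rewrite size_mkseq => hj <-.
  rewrite nth_mkseq // take_passed => /mapP [[x b']]; rewrite mem_filter => /andP[hx hxb] -> ->.
  have hm : (x, b') \in marks 0 Q by apply/mem_marks0; exists j.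
  exists x; first by apply/mapP; exists (x, b').
  by rewrite (rem_marks hj hxb) hx (pallet_atE hm) /=.
case=> x /mapP [[x' b] hm ->] /= /andP[hr /eqP <-]; rewrite (pallet_atE hm); apply: map_f.
have /mem_marks0 [j hj hxb] := hm; rewrite (rem_marks hj hxb) in hr.
apply/flattenP; exists (nth [::] (mkseq (fun j => take (passed_at j (h j)) (nth [::] Q j)) k) j).
  by rewrite mem_nth // size_mkseq.
rewrite nth_mkseq // take_passed; apply/mapP; exists (x', b) => //.
by rewrite mem_filter hr.
Qed.

Lemma mark_pos_lt x : x \in mark_pos Q -> x < N.
Proof.
case/mapP => -[y b] /mem_marks0 [j hj /marks_at_bounds /andP[_ hx]] -> /=.
by apply: ltn_trans hx _; apply: finish_lt_size.
Qed.

Lemma mark_pos_pallet x : x \in mark_pos Q -> pallet_at Q x \in map plt (flatten Q).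
Proof.
case/mapP => -[y b] hm -> /=; rewrite (pallet_atE hm); apply: map_f.
have /mem_marks0 [j hj hb] := hm; apply/flattenP; exists (nth [::] Q j); first exact: mem_nth.
by rewrite -(marks_seq_snd (start Q j) (nth [::] Q j)); apply/mapP; exists (y, b).
Qed.

(** [pallet_at] is a bijection from counted marks to open pallets. Of two counted marks with the
    same pallet, the later would have a removed predecessor; conversely, the least removed mark of
    an open pallet is counted. *)
Lemma count_open : count (counted w (mark_pos Q) rem (pallet_at Q)) (iota 0 N.+1) =
  num_open Q (conf h).
Proof.
rewrite -size_filter /num_open -(size_map (pallet_at Q)); apply: perm_size; apply: uniq_perm.
- rewrite map_inj_in_uniq ?filter_uniq ?iota_uniq // => x y.
  have sym_le u v : u < v -> pallet_at Q u = pallet_at Q v ->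
      counted w (mark_pos Q) rem (pallet_at Q) u ->
      ~ counted w (mark_pos Q) rem (pallet_at Q) v.
    move=> uv e /and4P[um ur _ _] /and4P[_ _ _ /hasP[]]; exists u.
      by rewrite mem_iota /= ltnS ltnW // mark_pos_lt.
    by rewrite uv um ur e eqxx.
  rewrite !mem_filter => /andP[cx _] /andP[cy _] e; case: (ltngtP x y) => // xy.
    by case: (sym_le _ _ xy e cx).
  by case: (sym_le _ _ xy (esym e) cy).
- by rewrite filter_uniq // undup_uniq.
move=> t; apply/mapP/idP => [[x]|].
  rewrite !mem_filter mem_undup => /andP[/and4P[xm xr /hasP [y _ /and3P[ym yr /eqP e]] _] _] ->.
  rewrite mark_pos_pallet // andbT; apply/andP; split.
    by apply/mem_conf; exists y; rewrite // yr e eqxx.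
  by apply/mem_removed; exists x; rewrite // xr eqxx.
rewrite mem_filter => /andP[/andP[/mem_conf [y ym /andP[yr /eqP ey]] /mem_removed [x xm hx]] _].
have ex : exists z, [&& z \in mark_pos Q, rem z & pallet_at Q z == t].
  by exists x; rewrite xm hx.
case: (ex_minnP ex) => z /and3P[zm zr /eqP ez] hmin; exists z => //.
rewrite mem_filter mem_iota /= ltnS ltnW ?mark_pos_lt // andbT /counted zm zr /=.
apply/andP; split.
  apply/hasP; exists y; last by rewrite ym yr ez ey eqxx.
  by rewrite mem_iota /= ltnS ltnW ?mark_pos_lt.
apply/hasP => -[u _ /and4P[uz um ur /eqP eu]].
have := hmin u; rewrite um ur -eu ez eqxx => /(_ isT); lia.
Qed.

End Valid.

Lemma passed_atS j x : passed_at j x.+1 = passed_at j x + (x \in map fst (marks_at j)).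
Proof.
rewrite -(count_uniq_mem _ (marks_seq_uniq _ _)) count_map /passed_at -!sum1_count.
rewrite [RHS]addnC (bigID (fun xb => xb.1 == x)) /=; congr (_ + _).
  apply: eq_bigl => xb; rewrite ltnS; case: eqP => [->|]; by rewrite ?leqnn ?andbT ?andbF.
by apply: eq_bigl => xb; rewrite ltnS (ltn_neqAle xb.1) andbC.
Qed.

Lemma passed_at_start j : passed_at j (start Q j) = 0.
Proof.
apply/eqP; rewrite -leqn0 leqNgt -has_count; apply/hasPn => -[x b] /marks_at_bounds /=.
by rewrite -leqNgt => /andP[].
Qed.

Lemma passed_at_finish j : passed_at j (finish Q j) = size (nth [::] Q j).
Proof.
rewrite -size_marks_at; apply/eqP; rewrite -all_count; apply/allP => -[x b].
by move/marks_at_bounds/andP => [].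
Qed.

Lemma conf_start h : (forall j, j < k -> h j = start Q j) -> conf h = Q.
Proof.
move=> hs; rewrite -[RHS](mkseq_nth [::]); apply/eq_in_map => j; rewrite mem_iota => hj.
by rewrite hs // passed_at_start drop0.
Qed.

Lemma size_conf h : size (conf h) = k. Proof. exact: size_mkseq. Qed.

Lemma nth_conf h j : j < k -> nth [::] (conf h) j = drop (passed_at j (h j)) (nth [::] Q j).
Proof. exact: nth_mkseq. Qed.

Lemma conf_stay h h' i : h' i = (h i).+1 -> (forall j, j != i -> h' j = h j) ->
  h i \notin map fst (marks_at i) -> conf h' = conf h.
Proof.
move=> hi hn nm; apply/eq_in_map => j _; case: (eqVneq j i) => [->|ji]; last by rewrite hn.
by rewrite hi passed_atS (negbTE nm) addn0.
Qed.

Lemma conf_move h h' i : i < k -> h' i = (h i).+1 -> (forall j, j != i -> h' j = h j) ->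
  h i \in map fst (marks_at i) -> trans_step (conf h) (conf h').
Proof.
move=> ik hi hn mm; have hc : passed_at i (h' i) = (passed_at i (h i)).+1.
  by rewrite hi passed_atS mm addn1.
exists i; rewrite ?size_conf // nth_conf //; split.
  by rewrite -size_eq0 size_drop subn_eq0 -ltnNge -hc passed_at_le.
apply: (@eq_from_nth _ [::]); rewrite ?size_set_nth !size_conf ?(maxn_idPr ik) // => j hj.
rewrite nth_set_nth /= !nth_conf //; case: (eqVneq j i) => [->|ji]; last by rewrite hn.
by rewrite hc -add1n -drop_drop drop1.
Qed.

Local Notation reachable := (reachable_index w k (mark_pos Q) (pallet_at Q) (minn N p) (start Q)).
Local Notation few_open := (okm w k (mark_pos Q) (pallet_at Q) (minn N p) (start Q)).

(** Open pallets have distinct representatives among the [N] input positions, so cutting [p] down to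
    [N] does not alter the test. *)
Lemma few_openE m : valid (dig N m) -> few_open m = (num_open Q (conf (dig N m)) <= p).
Proof.
move=> hv; rewrite /okm count_open //.
suff : num_open Q (conf (dig N m)) <= N by lia.
rewrite -(count_open hv) -size_filter -[X in _ <= X](size_iota 0).
apply: uniq_leq_size; first by rewrite filter_uniq ?iota_uniq.
move=> x; rewrite mem_filter !mem_iota /= => /andP[/and4P[xm _ _ _] _].
exact: mark_pos_lt xm.
Qed.

Lemma reachable_valid m : reachable m -> m < N.+1 ^ k /\ valid (dig N m).
Proof.
apply: RI_valid; [exact: start_le_finish | exact: finish_lt_size | exact: seqend_finish].
Qed.

(** Advancing a pointer over a mark is a transformation step; over any other token it keeps the
    configuration. *)
Lemma reachable_SR m : reachable m -> few_open m -> place_reachable (conf (dig N m)).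
Proof.
elim=> {m} [m hm hi|m x Rm IH om pm] ok.
  have Rm := RI_initial (mark_pos Q) (pallet_at Q) (minn N p) hm hi.
  have [_ hv] := reachable_valid Rm; rewrite few_openE // in ok.
  have e : conf (dig N m) = Q.
    by apply: conf_start => j hj; move/allP/(_ j): hi; rewrite mem_iota => /(_ hj)/eqP.
  by rewrite e in ok *; apply: SR_start.
have Rx := RI_push Rm om pm; have [_ hvx] := reachable_valid Rx.
have [_ hv] := reachable_valid Rm; rewrite few_openE // in ok.
case/hasP: pm => j; rewrite mem_iota /= => hj /andP[ne /eqP ex].
have lt_f : dig N m j < finish Q j.
  rewrite ltn_neqAle (andP (hv j hj)).2 andbT; apply: contraNneq ne => ->.
  exact: seqend_finish.
have lt_N : dig N m j < N by apply: ltn_trans (finish_lt_size p hj).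
have dj : dig N x j = (dig N m j).+1 by rewrite ex dig_incr // eqxx addn1.
have dl l : l != j -> dig N x l = dig N m l by move=> lj; rewrite ex dig_incr // (negbTE lj) addn0.
case: (boolP (dig N m j \in map fst (marks_at j))) => mm; last by rewrite (conf_stay dj dl mm); apply: IH.
by apply: SR_step (IH om) _ ok; apply: conf_move dj dl mm.
Qed.

Lemma SR_suffix C : place_reachable C -> size C = k /\ forall j, j < k ->
  exists2 c, c <= size (nth [::] Q j) & nth [::] C j = drop c (nth [::] Q j).
Proof.
elim=> [_|C0 C' _ [sC hC] [i hi [ne ->]] _].
  by split=> // j _; exists 0; rewrite ?drop0.
rewrite sC in hi; split; first by rewrite size_set_nth sC (maxn_idPr hi).
move=> j hj; rewrite nth_set_nth /=; case: eqP => [ji|_]; last exact: hC.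
have [c hc ec] := hC _ hi; exists c.+1; last by rewrite ji ec -add1n -drop_drop drop1.
by rewrite ji; move: ne; rewrite ec -size_eq0 size_drop subn_eq0 -ltnNge.
Qed.

(* If some pointer can step back over a token that is not a mark, the configuration does
   not change; otherwise the last step of the processing steps back over a mark. *)
Lemma SR_reachable m : m < N.+1 ^ k -> valid (dig N m) -> place_reachable (conf (dig N m)) -> reachable m.
Proof.
elim/ltn_ind: m => m IH hm hv hC.
(* The tuple with pointer [j] one token back has a smaller number, so induction applies to it. Its
   pointer [j] lies strictly before the closing [TSeq], hence it pushes [m]. *)
have back j : j < k -> start Q j < dig N m j -> place_reachable (conf (dig N (m - N.+1 ^ j))) -> reachable m.
  move=> hj hs hC1; have d0 : 0 < dig N m j by apply: leq_ltn_trans hs.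
  set m1 := m - _ in hC1; have em : m = m1 + N.+1 ^ j by rewrite /m1 subnK ?decr_dig.
  have p0 := powN_gt0 N j; have lt1 : m1 < m by rewrite em -{1}[m1]addn0 ltn_add2l.
  have hv1 : valid (dig N m1).
    move=> l hl; rewrite /m1 dig_decr //; have := hv l hl; case: eqP => [->|_] /=; lia.
  have R1 := IH m1 lt1 (ltn_trans lt1 hm) hv1 hC1.
  apply: (RI_push R1); first by rewrite few_openE // SR_open.
  apply/hasP; exists j; first by rewrite mem_iota.
  rewrite -em eqxx andbT; apply: (seqend_inside p hj).
  by have := hv j hj; rewrite /m1 dig_decr // eqxx; lia.
have dd j : 0 < dig N m j -> dig N m j = (dig N (m - N.+1 ^ j) j).+1.
  by move=> d0; rewrite dig_decr // eqxx; lia.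
have dn j l : 0 < dig N m j -> l != j -> dig N m l = dig N (m - N.+1 ^ j) l.
  by move=> d0 lj; rewrite dig_decr // (negbTE lj) subn0.
case: (boolP (initial w k (start Q) m)) => [hi|/allPn [j]]; first exact: RI_initial.
rewrite mem_iota /= => hj ne; have hs : start Q j < dig N m j.
  by rewrite ltn_neqAle ne; case/andP: (hv j hj).
case: (boolP (has (fun j => (start Q j < dig N m j) &&
    ((dig N m j).-1 \notin map fst (marks_at j))) (iota 0 k))) => [/hasP [i]|/hasPn nostay].
  rewrite mem_iota /= => ik /andP[si nm]; apply: (back i) => //.
  have d0 : 0 < dig N m i by apply: leq_ltn_trans si.
  rewrite -(conf_stay (dd i d0) (fun l => @dn i l d0)) //.
  by rewrite dig_decr // eqxx subn1.
have ismark i : i < k -> start Q i < dig N m i -> (dig N m i).-1 \in map fst (marks_at i).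
  by move=> ik si; have := nostay i; rewrite mem_iota /= => /(_ ik); rewrite si negbK.
have passedS i : i < k -> start Q i < dig N m i ->
    passed_at i (dig N m i) = (passed_at i (dig N m i).-1).+1.
  move=> ik si; rewrite -{1}(ltn_predK si) passed_atS ismark ?addn1 //.
(* Every pointer past its start now stands just behind a mark. Pointer [j] is one of them, so a bin
   is missing and the configuration is not the initial one: it arose by a step, in some sequence
   [i]. *)
move eC : (conf _) hC => C hC; case: hC eC => [_|C0 C' hC0 [i hi [nei ->]] _] eC.
  have := congr1 (fun C => size (nth [::] C j)) eC; rewrite /= nth_conf // size_drop passedS //.
  by have := passed_at_le j (dig N m j); rewrite passedS //; lia.
have [sC0 hs0] := SR_suffix hC0; rewrite sC0 in hi; have [c hc ec] := hs0 i hi.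
have hcS : c < size (nth [::] Q i) by move: nei; rewrite ec -size_eq0 size_drop subn_eq0 -ltnNge.
have ei : c.+1 = passed_at i (dig N m i).
  have := congr1 (fun C => size (nth [::] C i)) eC.
  rewrite /= nth_conf // nth_set_nth /= eqxx ec size_behead !size_drop.
  by have := passed_at_le i (dig N m i); lia.
have si : start Q i < dig N m i.
  rewrite ltnNge; apply/negP => le_s; have e : dig N m i = start Q i.
    by have /andP[h _] := hv i hi; lia.
  by rewrite e passed_at_start in ei.
have d0 : 0 < dig N m i by apply: leq_ltn_trans si.
apply: (back i) => //; suff -> : conf (dig N (m - N.+1 ^ i)) = C0 by [].
apply: (@eq_from_nth _ [::]); rewrite size_conf // => l hl; rewrite nth_conf //.
case: (eqVneq l i) => [->|li].
  rewrite dig_decr // eqxx subn1 ec; congr drop.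
  by move: ei; rewrite passedS // => -[].
have := congr1 (fun C => nth [::] C l) eC.
by rewrite /= nth_conf // nth_set_nth /= (negbTE li) => <-; rewrite dig_decr // (negbTE li) subn0.
Qed.

Lemma final_finish m : valid (dig N m) -> final w k m <-> forall j, j < k -> dig N m j = finish Q j.
Proof.
move=> hv; split=> [/allP hf j hj|hf]; last first.
  by apply/allP => j; rewrite mem_iota => hj; rewrite hf // seqend_finish.
have := hf j; rewrite mem_iota => /(_ hj) he; have /andP[h1 h2] := hv j hj.
apply/eqP; rewrite eqn_leq h2 leqNgt; apply/negP => h3.
by have := @seqend_inside Q p j (dig N m j) hj; rewrite h1 h3 he => /(_ isT).
Qed.

Lemma search_correct : (exists m, [/\ reachable m, few_open m & final w k m]) <-> solvable Q p.
Proof.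
rewrite solvableP; split=> [[m [Rm om fm]]|[C hC eC]].
  exists (conf (dig N m)); first exact: reachable_SR.
  have [_ hv] := reachable_valid Rm; have hf := (final_finish hv).1 fm.
  apply/allP => s /(nthP [::]) [j]; rewrite size_conf => hj <-.
  by rewrite nth_conf // hf // passed_at_finish drop_size.
(* Several tuples may represent the empty configuration; [final] demands the one with every pointer
   on its closing [TSeq]. *)
have [j hj|m hm head_cell] := @dig_exists N k (finish Q); first exact: ltnW (finish_lt_size p hj).
have hv : valid (dig N m) by move=> j hj; rewrite head_cell // leqnn start_le_finish.
have ec : conf (dig N m) = C.
  have [sC _] := SR_suffix hC; apply: (@eq_from_nth _ [::]); rewrite size_conf // => j hj.
  rewrite nth_conf // head_cell // passed_at_finish drop_size.
  by apply/esym/eqP; apply: (allP eC); rewrite mem_nth // sC.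
rewrite -ec in hC; exists m; split; first exact: SR_reachable.
- by rewrite few_openE // SR_open.
exact/final_finish.
Qed.

End Reachability.

(** * Well-formedness of the search program, and the conclusion *)

Lemma wf_le W W' p : W <= W' -> wf W p -> wf W' p.
Proof.
move=> le_W; elim: p => //= [a IHa b IHb|h c a IHa b IHb|h t v|h|h h'|h b IHb].
- by case/andP => /IHa -> /IHb ->.
- by case/and4P => ? ? /IHa -> /IHb ->; rewrite !andbT; lia.
- lia.
- lia.
- lia.
by case/and3P => ? -> /IHb ->; rewrite !andbT; lia.
Qed.

Lemma wf_Sq W a b : wf W a -> wf W b -> wf W (a ;; b).
Proof. by move=> /= -> ->. Qed.

Lemma wf_If W h c a b : h < W -> c < W.*2 -> wf W a -> wf W b -> wf W (If h c a b).
Proof. by move=> /= -> -> -> ->. Qed.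

(** The last head is [next_cell k.-1], of number [3 * k + 11], and the last track is 15; the width
    exceeds both. *)
Lemma wf_Main k : 0 < k -> wf (3 * k + 16) (Main k).
Proof.
move=> k0; set W := 3 * k + 16.
have hA c j a : j <= k -> (forall i, i < j -> c i < W.*2) -> wf W a -> wf W (AllIf c j a).
  elim: j => //= j IHj hj hc wa; rewrite IHj ?hc // ?andbT; last 2 first.
  - exact: ltnW.
  - by move=> i hi; apply: hc; apply: ltnW.
  by rewrite /ptr /W; lia.
have hF c v j : (forall i, i < j -> c i < W) -> wf W (SetFlags c v j).
  elim: j => //= j IHj hc; rewrite IHj //=; last by move=> i hi; apply: hc; apply: ltnW.
  by have := hc j (ltnSn j); rewrite /head_cell /W; lia.
have hSt j : j < k -> wf W (Starts j).
  elim: j => [|j IHj] hj /=; first by rewrite /seg /W; lia.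
  rewrite IHj ?(ltnW hj) //= /track_cell /seg !inE /W; lia.
have hP j : j <= k -> wf W (Push j).
  by elim: j => //= j IHj hj; rewrite IHj ?(ltnW hj) //= /track_cell /ptr /next_cell /W; lia.
have hR j : j <= k -> wf W (Rights j).
  by elim: j => //= j IHj hj; rewrite IHj ?(ltnW hj) //= /next_cell /W; lia.
have hL j b : j <= k -> (forall i, i < j -> ptr i \notin mod_heads b) -> wf W b -> wf W (Loops j b).
  elim: j => //= j IHj hj nb wb; rewrite IHj ?(ltnW hj) //; last first.
    by move=> i hi; apply: nb; apply: ltnW.
  rewrite andbT; apply/andP; split; first by rewrite /ptr /W; lia.
  apply/negP => /mod_heads_Loops [|[i hi /eqP]]; first by apply/negP; apply: nb.
  by rewrite /ptr; lia.
have hI j : j <= k -> wf W (InitT j).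
  elim: j => //= j IHj hj; rewrite IHj ?(ltnW hj) //=; apply: hL; first exact: ltnW.
    by move=> i _; rewrite inE /ptr /next_cell; lia.
  by rewrite /= /next_cell /W; lia.
have hsmall q : wf 16 q -> wf W q by apply: wf_le; rewrite /W; lia.
have hRem : wf W (RemPass k).
  rewrite /RemPass /RemStep /= !hF /=; last 2 first.
  - by move=> i hi; rewrite /ptr /W; lia.
  - by move=> i hi; rewrite /seg /W; lia.
  by rewrite !mod_heads_SetFlags /track_cell /W /=; lia.
have hC : wf W (Core k).
  apply: wf_Sq; first by apply: hA => // [i hi|]; [rewrite /head_cell /seg /W; lia | apply: hsmall].
  apply: wf_If => //; try by rewrite /track_cell /W; lia.
  apply: wf_Sq => //; apply: wf_Sq; first exact: hsmall.
  apply: wf_If => //; try by rewrite /track_cell /W; lia.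
  apply: wf_Sq; last exact: hP.
  by apply: hA => // [i hi|]; [rewrite /track_cell /W; lia | apply: hsmall].
have hB : wf W (Body k).
  by apply: wf_Sq => //; apply: wf_Sq; [rewrite /= /W; lia | exact: hR].
apply: wf_Sq; first exact: hsmall.
apply: wf_Sq; first by apply: hSt; rewrite prednK.
apply: wf_Sq; first exact: hsmall.
apply: wf_Sq; first exact: hI.
apply: hL => // i hi; apply/negP.
by move=> /mod_heads_Body []; [| | case=> l _]; rewrite /ptr /next_cell; lia.
Qed.

Theorem theorem7 : forall k : nat, 0 < k -> poly_time_solvable k.
Proof.
move=> k k0; have le4 : 4 <= 3 * k + 16 by lia.
have lt7 : ANS < 3 * k + 16 by lia.
have [M [c [d h]]] := poly_time_cmd le4 (wf_Main k0) lt7.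
exists M, c, d => Q p /and4P[/eqP sQ _ _ _] _.
exists (trk (sem (Main k) (init_state (enc_input Q p))) ANS 0); split.
  by apply: h; apply: size_input.
by rewrite -sQ in k0 *; apply: iff_trans (MainP p k0) (search_correct Q p).
Qed.
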